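(* Let $X\subset\Lambda^{\mathbb{Z}}$ be a shift space which has a safe symbol (in particular, $X$ may be any hereditary shift). Then $X$ has positive topological entropy if and only if $X$ has uncountably many ergodic $\sigma$-invariant Borel probability measures.
   Context: Fix $n\ge 2$, $\Lambda=\{0,1,\ldots,n-1\}$ and $\Omega=\Lambda^{\mathbb{Z}}$ with the product topology induced by the discrete topology on $\Lambda$. The shift map $\sigma\colon\Omega\to\Omega$ is $\sigma(x)_i=x_{i+1}$. A shift space is a nonempty closed set $X\subset\Omega$ with $\sigma(X)=X$. A symbol $a\in\Lambda$ is a safe symbol for $X$ if for every $y\in X$, every $z\in\Lambda^{\mathbb{Z}}$ obtained by replacing some (arbitrarily many) entries of $y$ by $a$ belongs to $X$. A shift space $X$ is hereditary if $x\in X$, $y\in\Lambda^{\mathbb{Z}}$ and $y\le x$ coordinate-wise imply $y\in X$; then $0$ is a safe symbol for $X$. *)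

(* Defs.v *)
From HB Require Import structures.
From mathcomp Require Import all_boot all_order all_algebra.
From mathcomp Require Import all_classical all_reals all_analysis.
Set Implicit Arguments.
Unset Strict Implicit.
Unset Printing Implicit Defensive.
Import Order.TTheory GRing.Theory Num.Theory numFieldNormedType.Exports.
Local Open Scope classical_set_scope.
Local Open Scope ring_scope.

(* The alphabet has n + 2 symbols: letting n range over nat covers exactly the
   alphabets {0, ..., N - 1} with N >= 2, and keeps the type pointed. *)
Definition alphabet (n : nat) := 'I_n.+2.

HB.instance Definition _ (n : nat) := isPointed.Build 'I_n.+1 ord0.

Definition fullshift (n : nat) :=
  prod_topology (fun _ : int => discrete_topology (alphabet n)).

Definition shift (n : nat) (x : fullshift n) : fullshift n :=
  fun i => x (i + 1).

Definition shift_space (n : nat) (X : set (fullshift n)) :=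
  [/\ X !=set0, closed X & @shift n @` X = X].

Definition safe_symbol (n : nat) (X : set (fullshift n)) (a : alphabet n) :=
  forall y z : fullshift n,
    X y -> (forall i : int, z i = y i \/ z i = a) -> X z.

Definition hereditary (n : nat) (X : set (fullshift n)) :=
  forall x y : fullshift n,
    X x -> (forall i : int, (y i : alphabet n) <= (x i : alphabet n))%N -> X y.

Definition occurs (n : nat) (X : set (fullshift n)) (m : nat)
    (w : m.-tuple (alphabet n)) : Prop :=
  exists x : fullshift n, exists i : int,
    X x /\ forall j : 'I_m, tnth w j = x (i + (j : nat)%:Z).

Definition block_count (n : nat) (X : set (fullshift n)) (m : nat) : nat :=
  #|[pred w : m.-tuple (alphabet n) | `[< occurs X w >]]|.

(* The limit exists for every shift space, by subadditivity of
   m |-> ln (block_count X m); the term m = 0 is irrelevant to it. *)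
Definition topological_entropy (R : realType) (n : nat)
    (X : set (fullshift n)) : R :=
  lim ((fun m : nat => ln ((block_count X m)%:R : R) / m%:R) @ \oo).

Definition borel (n : nat) := g_sigma_algebraType (@open (fullshift n)).

Definition shift_invariant (R : realType) (n : nat)
    (mu : probability (borel n) R) :=
  forall A : set (borel n), measurable A -> mu (@shift n @^-1` A) = mu A.

Definition ergodic (R : realType) (n : nat) (mu : probability (borel n) R) :=
  forall A : set (borel n),
    measurable A -> @shift n @^-1` A = A -> mu A = 0%E \/ mu A = 1%E.

(* Borel probability measures on X are identified with the Borel probability
   measures on the full shift giving mass 1 to X, which is closed. *)
Definition ergodic_measures (R : realType) (n : nat) (X : set (fullshift n)) :
    set (probability (borel n) R) :=
  [set mu : probability (borel n) R |
    [/\ mu X = 1%E, shift_invariant mu & ergodic mu]].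

(* The library's measures are functions on all subsets, unconstrained outside
   the sigma-algebra, so measures must be counted through their restrictions
   to Borel sets. *)
Definition borel_restriction (R : realType) (n : nat)
    (mu : probability (borel n) R) :
    {A : set (borel n) | measurable A} -> \bar R :=
  fun A => mu (sval A).

Definition uncountably_many_measures (R : realType) (n : nat)
    (M : set (probability (borel n) R)) :=
  ~ countable [set borel_restriction mu | mu in M].

Arguments topological_entropy R {n} X.
Arguments ergodic_measures R {n} X.

(* Main.v *)
Require Import Defs.
From HB Require Import structures.
From mathcomp Require Import all_boot all_order all_algebra.
From mathcomp Require Import all_classical all_reals all_analysis.
From mathcomp Require Import measurable_realfun.
From mathcomp Require Import zify ring lra.
Set Implicit Arguments.
Unset Strict Implicit.
Unset Printing Implicit Defensive.
Import Order.TTheory GRing.Theory Num.Theory numFieldNormedType.Exports.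
Local Open Scope classical_set_scope.
Local Open Scope ring_scope.

(** Fix a safe symbol [a] and call the other symbols non-safe. Since every
    non-safe entry of a point of [X] may be replaced by [a], one point with [K]
    non-safe entries in a window of length [k] produces [2 ^ K] blocks of length
    [k]. Conversely, words of length [k] with at most [c * k] non-safe entries
    are few: their exponential growth rate tends to [0] with [c]. So the entropy
    is positive exactly when non-safe symbols occur in [X] with positive
    frequency ([entropy_gt0], [entropy_gt0_dense_points]); the limit that
    defines the entropy exists by Fekete's argument ([fekete]).

    If an invariant measure on [X] charges the event that the entry at [0] is
    non-safe, then averaging over a window yields points with at least that
    frequency of non-safe symbols ([measure_dense_point]), and the entropy is
    positive. An invariant measure that does not charge it is the point mass at
    the constant sequence [a] ([measure_safe_point]). So without positive
    entropy there is at most one ergodic measure.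

    Suppose that the entropy is positive. Empirical frequencies along points
    with many non-safe symbols converge, along a free ultrafilter, to a
    shift-invariant finitely additive content on the cylinder sets, carried by
    [X] and charging the non-safe symbols ([inv_content_exists]). Maximising in
    turn the value of the content on the non-safe event and then on each
    cylinder set of an enumeration leaves a single content [m], which is extreme
    among the invariant contents on [X] ([extreme_content_exists]). For [p] in
    [0, 1] toss independent coins that fall heads with probability [p], one for
    each coordinate, and replace by [a] the entries whose coin falls tails. The
    law of the resulting random point is carried by [X] and gives the non-safe
    event the mass [p] times its mass under [m], so different [p] give different
    measures ([thinned_measure]).

    These measures are ergodic because the joint law of the [m]-random point and
    the coins is ([joint_ergodic]). Let [G] be an invariant event of positive
    probability [c] less than [1]. A cylinder set close to [G] is independent of
    coins that are far away, and by invariance every coin can be moved far away;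
    hence [G] and the point are jointly independent of the coins
    ([joint_invariant_coin]). The laws of the point given [G] and given its
    complement are invariant contents on [X] that average to [m], so by
    extremality both are [m]. Therefore [G] is independent of all cylinder sets,
    hence of itself, which is absurd. *)

(** * Cylinder sets *)

Section CylinderSets.
Variable B : Type.
Implicit Types (s t : seq int) (x y : int -> B) (C D : set (int -> B)).

Definition determined s C :=
  forall x y, (forall i, i \in s -> x i = y i) -> C x -> C y.

Definition cylset C := exists s, determined s C.

Definition translate x : int -> B := fun i => x (i + 1).

Lemma determined_sub s t C : {subset s <= t} -> determined s C -> determined t C.
Proof. by move=> st dC x y xy; apply: dC => i /st /xy. Qed.

Lemma determinedC s C : determined s C -> determined s (~` C).
Proof. by move=> dC x y xy nCx Cy; apply/nCx/dC/Cy => i /xy. Qed.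

Lemma determinedI s C D :
  determined s C -> determined s D -> determined s (C `&` D).
Proof. by move=> dC dD x y xy [Cx Dx]; split; [apply: dC Cx|apply: dD Dx]. Qed.

Lemma cylsetC C : cylset C -> cylset (~` C).
Proof. by case=> s dC; exists s; exact: determinedC. Qed.

Lemma cylsetI C D : cylset C -> cylset D -> cylset (C `&` D).
Proof.
move=> [s dC] [t dD]; exists (s ++ t); apply: determinedI.
  by apply: determined_sub dC => i; rewrite mem_cat => ->.
by apply: determined_sub dD => i; rewrite mem_cat => ->; rewrite orbT.
Qed.

Lemma cylsetU C D : cylset C -> cylset D -> cylset (C `|` D).
Proof.
move=> cC cD; rewrite -[_ `|` _]setCK setCU.
by apply/cylsetC/cylsetI; exact: cylsetC.
Qed.

Lemma cylsetD C D : cylset C -> cylset D -> cylset (C `\` D).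
Proof. by move=> cC cD; rewrite setDE; apply: cylsetI => //; exact: cylsetC. Qed.

Lemma cylset0 : cylset set0. Proof. by exists [::]. Qed.

Lemma cylsetT : cylset setT. Proof. by exists [::]. Qed.

Lemma cylset_bigcup n (F : nat -> set (int -> B)) :
  (forall i, cylset (F i)) -> cylset (\big[setU/set0]_(i < n) F i).
Proof.
move=> cF; elim: n => [|n IH]; first by rewrite big_ord0; exact: cylset0.
by rewrite big_ord_recr; exact: cylsetU.
Qed.

Lemma determined_translate s C :
  determined s C -> determined [seq i + 1 | i <- s] (translate @^-1` C).
Proof.
move=> dC x y xy; apply: dC => i si; rewrite /translate; apply: xy.
by apply: map_f.
Qed.

Lemma cylset_translate C : cylset C -> cylset (translate @^-1` C).
Proof. by case=> s /determined_translate; exists [seq i + 1 | i <- s]. Qed.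

Lemma cylset_coord (i : int) (P : set B) : cylset [set x | P (x i)].
Proof. by exists [:: i] => x y /(_ i (mem_head _ _)) /= ->. Qed.

End CylinderSets.

Lemma free_ultrafilter :
  exists2 U : set_system nat, UltraFilter U & \oo `<=` U.
Proof.
have [U [UU oU]] := @ultraFilterLemma nat \oo _.
by exists U.
Qed.

(** Compactness of the space of sequences, in the form used for countable
    additivity: each coordinate of a choice of points is constant along a free
    ultrafilter, and the constants form a common point. *)
Lemma cylset_compact (B : pointedType) (C : nat -> set (int -> B)) :
  finite_set [set: B] -> (forall n, cylset (C n)) ->
  (forall n, C n !=set0) -> (forall m n, (m <= n)%N -> C n `<=` C m) ->
  exists x, forall n, C n x.
Proof.
move=> finB cC C0 Cmono.
have [U UU oU] := free_ultrafilter.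
have [X CX] := choice C0.
have /choice[x Ux] (i : int) : exists b, U [set n | X n i = b].
  apply: contrapT => nU.
  have UC b : U [set n | X n i <> b].
    have [] // := in_ultra_setVsetC [set n | X n i = b] UU.
    by move=> Ub; case: nU; exists b.
  have /filter_ex[n] : U (\bigcap_(b in [set: B]) [set n | X n i <> b]).
    by rewrite -(fset_setK finB); apply: filter_bigI.
  by move/(_ (X n i) I); apply.
exists x => n; have [s dC] := cC n.
have : U [set m | (n <= m)%N /\ forall i, i \in s -> X m i = x i].
  apply: filterI; first by apply: oU; exists n.
  elim: s {dC} => [|i s IH]; first by apply: filterS filterT => m _ i.
  apply: filterS (filterI (Ux i) IH) => m [/= Xi Xs] j.
  by rewrite inE => /predU1P[->|/Xs].
by move=> /filter_ex[m [nm Xx]]; apply: (dC (X m)) => //; exact: Cmono (CX m).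
Qed.

(** * From contents on cylinder sets to measures *)

(** A separate name for the space of sequences, so that the algebra of cylinder
    sets attached to it does not interfere with other structures on
    [int -> B]. *)
Definition cylspace (B : Type) := int -> B.

HB.instance Definition _ (B : pointedType) := Pointed.copy (cylspace B) (int -> B).

Definition cylset_display : Type -> measure_display. Proof. exact. Qed.

HB.instance Definition _ (B : pointedType) :=
  isAlgebraOfSets.Build (cylset_display B) (cylspace B)
    (@cylset0 B) (@cylsetU B) (@cylsetC B).

Section Contents.
Variables (R : realType) (B : Type).
Implicit Types (C D : set (int -> B)) (m : set (int -> B) -> R).

Record prob_content m : Prop := ProbContent {
  content_ge0 : forall C, cylset C -> 0 <= m C;
  content_additive : forall C D, cylset C -> cylset D ->
    C `&` D = set0 -> m (C `|` D) = m C + m D;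
  content_setT : m setT = 1 }.

Definition shift_invariant_content m :=
  forall C, cylset C -> m (@translate B @^-1` C) = m C.

(** The support clause is the finitely additive form of full mass on a closed
    set: the complement of a closed set is a union of cylinder sets that miss
    it. *)
Record inv_content (X : set (int -> B)) m : Prop := InvContent {
  inv_content_prob : prob_content m;
  inv_content_shift : shift_invariant_content m;
  inv_content_support : forall C, cylset C -> C `&` X = set0 -> m C = 0 }.

Variables (m : set (int -> B) -> R) (pm : prob_content m).

Lemma content0 : m set0 = 0.
Proof.
have := content_additive pm (cylset0 B) (cylset0 B) (set0I _).
by rewrite setU0; lra.
Qed.

Lemma content_split C D : cylset C -> cylset D -> m C = m (C `&` D) + m (C `\` D).
Proof.
move=> cC cD; rewrite -content_additive ?setUIDK//; last 2 first.
- exact: cylsetD.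
- by rewrite -subset0 => x [[_ ?] []].
- exact: cylsetI.
Qed.

Lemma content_mono C D : cylset C -> cylset D -> C `<=` D -> m C <= m D.
Proof.
move=> cC cD CD; rewrite (content_split cD cC) setIidr// lerDl.
by apply: content_ge0 => //; exact: cylsetD.
Qed.

Lemma content_le1 C : cylset C -> m C <= 1.
Proof.
by move=> cC; rewrite -(content_setT pm) content_mono//; exact: cylsetT.
Qed.

Lemma content_subadditive2 C D : cylset C -> cylset D -> m (C `|` D) <= m C + m D.
Proof.
move=> cC cD; rewrite (content_split (cylsetU cC cD) cC) lerD//.
  by rewrite setIidr//; exact: subsetUl.
apply: content_mono => //; first by apply: cylsetD => //; exact: cylsetU.
by move=> x [[]].
Qed.

Lemma content_bigcup_le n (F : nat -> set (int -> B)) : (forall i, cylset (F i)) ->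
  m (\big[setU/set0]_(i < n) F i) <= \sum_(i < n) m (F i).
Proof.
move=> cF; elim: n => [|n IH]; first by rewrite !big_ord0 content0.
rewrite !big_ord_recr /= (le_trans (content_subadditive2 _ _))//.
  exact: cylset_bigcup.
by rewrite lerD2r.
Qed.

Lemma content_bigcup_trivIset n (F : nat -> set (int -> B)) :
  (forall i, cylset (F i)) -> trivIset setT F ->
  m (\big[setU/set0]_(i < n) F i) = \sum_(i < n) m (F i).
Proof.
move=> cF tF; elim: n => [|n IH]; first by rewrite !big_ord0 content0.
rewrite !big_ord_recr /= content_additive ?IH//; first exact: cylset_bigcup.
rewrite -subset0 => x [/=]; rewrite -bigcup_mkord => -[i /= ilt Fix] Fnx.
have eq_in := tF i n I I (ex_intro _ x (conj Fix Fnx)).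
by rewrite eq_in ltnn in ilt.
Qed.

End Contents.

Section Extension.
Variables (R : realType) (B : pointedType).
Hypothesis finB : finite_set [set: B].
Variables (m : set (int -> B) -> R) (pm : prob_content m).

Let m0 (C : set (cylspace B)) : \bar R :=
  if `[< cylset C >] then (m C)%:E else 0%E.

Let m0E C : cylset C -> m0 C = (m C)%:E.
Proof. by move=> cC; rewrite /m0 asboolT. Qed.

Let m0_ge0 C : (0 <= m0 C)%E.
Proof. by rewrite /m0; case: asboolP => // cC; rewrite lee_fin content_ge0. Qed.

Let m0_semi_additive : measure_function.semi_additive m0.
Proof.
move=> F n cF tF cU; rewrite m0E// content_bigcup_trivIset// -sumEFin.
by apply: eq_bigr => i _; rewrite m0E//; exact: cF.
Qed.

HB.instance Definition _ := isContent.Build _ _ _ m0 m0_ge0 m0_semi_additive.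

Let cover_finite (D : set (int -> B)) (A : nat -> set (int -> B)) :
  (forall i, cylset (A i)) -> cylset D -> D `<=` \bigcup_i A i ->
  exists n, D `<=` \big[setU/set0]_(i < n) A i.
Proof.
move=> cA cD DA; apply: contrapT => /forallNP nD.
pose C n := D `\` \big[setU/set0]_(i < n) A i.
have [|n|p q pq|x Cx] := @cylset_compact B C finB.
- by move=> n; apply: cylsetD => //; exact: cylset_bigcup.
- apply: contrapT => nC; apply: (nD n) => x Dx; apply: contrapT => nx.
  by apply: nC; exists x.
- by apply: setDS; apply: subset_bigsetU.
have [Dx _] := Cx 0%N.
have [i _ Aix] := DA _ Dx.
by have [_] := Cx i.+1; apply; rewrite big_ord_recr; right.
Qed.

Let m0_sigma_subadditive : measurable_subset_sigma_subadditive m0.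
Proof.
move=> D A cA cD DA; have [n DAn] := cover_finite cA cD DA.
rewrite m0E//; apply: (@le_trans _ _ (\sum_(i < n) m0 (A i))%E); last first.
  rewrite -(big_mkord xpredT (fun i => m0 (A i))).
  by apply: nneseries_lim_ge => k _.
rewrite (eq_bigr (fun i : 'I_n => (m (A i))%:E)); last first.
  by move=> i _; rewrite m0E//; exact: cA.
rewrite sumEFin lee_fin (le_trans _ (content_bigcup_le pm _ cA))//.
by apply: content_mono => //; exact: cylset_bigcup.
Qed.

HB.instance Definition _ :=
  Content_SigmaSubAdditive_isMeasure.Build _ _ _ m0 m0_sigma_subadditive.

(** Countable additivity is automatic: a cylinder set covered by countably many
    cylinder sets is covered by finitely many of them. *)
Lemma content_extension :
  exists P : probability (g_sigma_algebraType (@cylset B)) R,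
    forall C, cylset C -> P C = (m C)%:E.
Proof.
pose M := measure_extension m0.
have ME C : cylset C -> M C = (m C)%:E.
  by move=> cC; rewrite /M /measure_extension measurable_mu_extE /= ?m0E.
have M1 : M setT = 1%E by rewrite ME ?(content_setT pm)//; exact: cylsetT.
pose H := Measure_isProbability.Build _ _ _ M M1.
by exists (HB.pack_for (probability (g_sigma_algebraType (@cylset B)) R) M H).
Qed.

End Extension.

(** * Approximation by cylinder sets *)
Section RealProbability.
Context d (T : measurableType d) (R : realType) (P : probability T R).
Implicit Types A E C : set T.

Definition prob A : R := fine (P A).

Lemma probE A : measurable A -> P A = (prob A)%:E.
Proof. by move=> mA; rewrite /prob fineK// fin_num_measure. Qed.

Lemma prob_ge0 A : 0 <= prob A.
Proof. exact: fine_ge0. Qed.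

Lemma prob_setT : prob setT = 1.
Proof. by rewrite /prob probability_setT. Qed.

Lemma probU A E : measurable A -> measurable E -> A `&` E = set0 ->
  prob (A `|` E) = prob A + prob E.
Proof.
move=> mA mE AE; apply: EFin_inj; rewrite EFinD -!probE ?measureU//.
exact: measurableU.
Qed.

Lemma prob_split A E : measurable A -> measurable E ->
  prob A = prob (A `&` E) + prob (A `\` E).
Proof.
move=> mA mE; rewrite -probU ?setUIDK//; first exact: measurableI.
  exact: measurableD.
by rewrite -subset0 => x [[_ ?] []].
Qed.

Lemma le_prob A E : measurable A -> measurable E -> A `<=` E -> prob A <= prob E.
Proof.
by move=> mA mE AE; rewrite (prob_split mE mA) setIidr// lerDl prob_ge0.
Qed.

Lemma probC A : measurable A -> prob (~` A) = 1 - prob A.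
Proof.
move=> mA; have := prob_split measurableT mA.
by rewrite prob_setT setTI setTD; lra.
Qed.

Lemma probU_le A E : measurable A -> measurable E ->
  prob (A `|` E) <= prob A + prob E.
Proof.
move=> mA mE; rewrite (prob_split (measurableU _ _ mA mE) mA).
rewrite setIidr; last exact: subsetUl.
rewrite lerD2l le_prob//; first by apply: measurableD => //; exact: measurableU.
by move=> x [[]].
Qed.

Lemma prob_bigcup_le n (F : nat -> set T) : (forall i, measurable (F i)) ->
  prob (\big[setU/set0]_(i < n) F i) <= \sum_(i < n) prob (F i).
Proof.
move=> mF; elim: n => [|n IH]; first by rewrite !big_ord0 /prob measure0.
rewrite !big_ord_recr /= (le_trans (probU_le _ _))//; last by rewrite lerD2r.
exact: bigsetU_measurable.
Qed.

Definition symdiff A C := (A `\` C) `|` (C `\` A).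

Lemma measurable_symdiff A C :
  measurable A -> measurable C -> measurable (symdiff A C).
Proof. by move=> mA mC; apply: measurableU; exact: measurableD. Qed.

Lemma symdiff_sym A C : symdiff A C = symdiff C A.
Proof. exact: setUC. Qed.

Lemma symdiffC A C : symdiff (~` A) (~` C) = symdiff A C.
Proof. by rewrite /symdiff !setDE !setCK setUC setIC [C `&` _]setIC. Qed.

Lemma prob_symdiff_le A C E : measurable A -> measurable C -> measurable E ->
  prob (A `&` E) <= prob (C `&` E) + prob (symdiff A C).
Proof.
move=> mA mC mE; have mAC := measurable_symdiff mA mC.
apply: le_trans (probU_le _ _) => //; last exact: measurableI.
apply: le_prob; first exact: measurableI.
  by apply: measurableU => //; exact: measurableI.
move=> x [Ax Ex]; have [Cx|nCx] := pselect (C x); first by left.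
by right; left.
Qed.

Lemma prob_symdiff A C E : measurable A -> measurable C -> measurable E ->
  `|prob (A `&` E) - prob (C `&` E)| <= prob (symdiff A C).
Proof.
move=> mA mC mE; have := prob_symdiff_le mA mC mE.
have := prob_symdiff_le mC mA mE; rewrite symdiff_sym => h1 h2.
by rewrite ler_norml; apply/andP; split; lra.
Qed.

(** Continuity from above along the tails, which decrease to the empty set. *)
Lemma prob_bigcup_tail (F : nat -> set T) (e : R) : (forall i, measurable (F i)) ->
  0 < e -> exists n, prob (\bigcup_i F i `\` \big[setU/set0]_(i < n) F i) < e.
Proof.
move=> mF e0; pose D n := \bigcup_i F i `\` \big[setU/set0]_(i < n) F i.
have mD n : measurable (D n).
  by apply: measurableD; [exact: bigcupT_measurable|exact: bigsetU_measurable].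
have D0 : \bigcap_n D n = set0.
  rewrite -subset0 => x Dx; have [[i _ Fix] _] := Dx 0%N I.
  by have [_] := Dx i.+1 I; apply; rewrite big_ord_recr; right.
have : P \o D @ \oo --> P (\bigcap_n D n).
  apply: nonincreasing_cvg_mu => //.
  - by have := probE (mD 0%N); rewrite /= => ->; rewrite ltry.
  - by rewrite D0.
  - by move=> p q pq; apply/subsetPset; apply: setDS; apply: subset_bigsetU.
rewrite D0 measure0 => cD.
have /cvgrPdist_lt/(_ _ e0)[n _ /(_ n (leqnn n))] :
    (fun n => prob (D n)) @ \oo --> (0 : R) by exact: (fine_cvg cD).
by rewrite sub0r normrN ger0_norm ?prob_ge0// => ?; exists n.
Qed.

End RealProbability.

Section MeasureOnSequences.
Context (B : pointedType) (R : realType).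
Local Notation seqs := (g_sigma_algebraType (@cylset B)).
Variable P : probability seqs R.

Lemma cylset_measurable (C : set seqs) : cylset C -> measurable C.
Proof. exact: sub_sigma_algebra. Qed.

(** The sets that can be approximated form a sigma-algebra; a countable union is
    first cut to finitely many terms. *)
Lemma cylset_dense (A : set seqs) (e : R) : measurable A -> 0 < e ->
  exists2 C : set seqs, cylset C & prob P (symdiff A C) < e.
Proof.
move=> mA; move: e.
pose H := [set A : set seqs | measurable A /\ forall e : R, 0 < e ->
  exists2 C : set seqs, cylset C & prob P (symdiff A C) < e].
suff /(_ A mA)[] : @measurable _ seqs `<=` H by [].
apply: smallest_sub; last first.
  move=> C cC; split=> [|e e0]; first exact: cylset_measurable.
  by exists C => //; rewrite /symdiff !setDv setU0 /prob measure0.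
split.
- split=> [|e e0]; first exact: measurable0.
  exists set0; first exact: cylset0.
  by rewrite /symdiff !setDv setU0 /prob measure0.
- move=> F [mF aF]; rewrite setTD; split=> [|e /aF[C cC eC]].
    exact: measurableC.
  by exists (~` C); rewrite ?symdiffC//; exact: cylsetC.
suff HU (F : nat -> set seqs) : (forall i, H (F i)) -> H (\bigcup_i F i).
  exact: HU.
move=> HF; have mF i : measurable (F i) := (HF i).1.
split=> [|e e0]; first exact: bigcupT_measurable.
have e2 : 0 < e / 2 by lra.
have [n nF] := prob_bigcup_tail P mF e2.
have d0 : 0 < e / 2 / n.+1%:R by rewrite divr_gt0.
have /choice[C cC] i : exists C : set seqs,
    cylset C /\ prob P (symdiff (F i) C) < e / 2 / n.+1%:R.
  by have [C] := (HF i).2 _ d0; exists C.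
exists (\big[setU/set0]_(i < n) C i).
  by apply: cylset_bigcup => i; have [] := cC i.
have mC i : measurable (C i) by apply: cylset_measurable; have [] := cC i.
pose S := \big[setU/set0]_(i < n) symdiff (F i) (C i).
have mS : measurable S.
  by apply: bigsetU_measurable => i _; exact: measurable_symdiff.
have mT : measurable (\bigcup_i F i `\` \big[setU/set0]_(i < n) F i).
  by apply: measurableD; [exact: bigcupT_measurable|exact: bigsetU_measurable].
apply: (@le_lt_trans _ _ (e / 2 / n.+1%:R * n%:R +
    prob P (\bigcup_i F i `\` \big[setU/set0]_(i < n) F i))); last first.
  rewrite [ltRHS]splitr ler_ltD// -mulrA ger_pMr// mulrC ler_pdivrMr// mul1r.
  by rewrite ler_nat.
apply: (@le_trans _ _ (prob P S +
    prob P (\bigcup_i F i `\` \big[setU/set0]_(i < n) F i))); last first.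
  rewrite lerD2r.
  have /le_trans : prob P S <= \sum_(i < n) prob P (symdiff (F i) (C i)).
    apply: (@prob_bigcup_le _ _ _ P n (fun i => symdiff (F i) (C i))).
    by move=> i; exact: measurable_symdiff.
  apply.
  have -> : e / 2 / n.+1%:R * n%:R = \sum_(i < n) e / 2 / n.+1%:R.
    by rewrite sumr_const card_ord mulr_natr.
  apply: ler_sum => i _.
  by apply/ltW; have [] := cC i.
rewrite (le_trans _ (probU_le P mS mT))//; apply: le_prob.
- apply: measurable_symdiff; first exact: bigcupT_measurable.
  exact: bigsetU_measurable.
- exact: measurableU.
rewrite /S -(bigcup_mkord n (fun i => symdiff (F i) (C i))) -!bigcup_mkord.
move=> x [[[i _ Fix] nC]|[[i /= ni Cix] nF']].
- have [[j /= nj Fjx]|nFx] := pselect (bigcup `I_n F x).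
    left; exists j => //; left; split=> // Cjx; apply: nC.
    by exists j.
  by right; split=> //; exists i.
- by left; exists i => //; right; split=> // Fix; apply: nF'; exists i.
Qed.

Lemma measurable_translate : measurable_fun setT (@translate B : seqs -> seqs).
Proof.
apply: (@measurability _ _ seqs seqs setT _ (@cylset B)) => //.
move=> _ [C cC <-]; rewrite setTI; apply: cylset_measurable.
exact: (@cylset_translate B C).
Qed.

Lemma cylset_measure_unique (Q : {measure set seqs -> \bar R}) :
  (forall C, cylset C -> Q C = P C) -> forall A, measurable A -> Q A = P A.
Proof.
move=> QP A mA; apply: (@measure_unique _ R seqs (@cylset B) (fun=> setT)) => //.
- exact: cylsetI.
- by move=> _; exact: cylsetT.
- by rewrite bigcup_const//; exists 0%N.
- by move=> _; rewrite QP ?probE ?ltry//; exact: cylsetT.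
Qed.

Lemma translate_invariant (m : set seqs -> R) :
  shift_invariant_content m -> (forall C, cylset C -> P C = (m C)%:E) ->
  forall A : set seqs, measurable A -> P (@translate B @^-1` A) = P A.
Proof.
move=> im Pm A mA; pose Q : {measure set seqs -> \bar R} :=
  measure_function_pushforward__canonical__measure_function_Measure
    P measurable_translate.
apply: (@cylset_measure_unique Q) mA => C cC.
rewrite [RHS]Pm// -im// -Pm//; exact: cylset_translate.
Qed.

End MeasureOnSequences.

(** * Ultrafilter limits of contents *)
Lemma ultra_fmap (S T : Type) (f : S -> T) (F : set_system S) :
  UltraFilter F -> UltraFilter (f @ F).
Proof.
move=> UF; split=> [|G PG FG]; first exact: fmap_proper_filter.
apply/seteqP; split=> A; last exact: FG.
move=> GA; have [//|FnA] := in_ultra_setVsetC (f @^-1` A) UF.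
have GnA : G (~` A) by apply: FG.
by have [x []] := filter_ex (filterI GA GnA).
Qed.

Section Ultralimit.
Variables (R : realType) (U : set_system nat).
Hypotheses (UU : UltraFilter U) (oU : \oo `<=` U).
Implicit Types f g : nat -> R.

Definition ulim f : R := lim (f @ U).

Lemma ulim_cvg f : U [set n | 0 <= f n <= 1] -> f @ U --> ulim f.
Proof.
move=> f01; have := @segment_compact R 0 1; rewrite compact_ultra => cpt.
have fU : (f @ U) `[0, 1]%classic.
  rewrite /fmap /=; apply: filterS f01 => n /= fn; by rewrite in_itv.
have [l [_ fl]] := cpt (f @ U) (ultra_fmap f UU) fU.
by rewrite /ulim (cvg_lim _ fl).
Qed.

Lemma ulimE f l : f @ U --> l -> ulim f = l.
Proof. by move=> fl; apply: cvg_lim. Qed.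

Lemma ulim_near_cst f l : U [set n | f n = l] -> ulim f = l.
Proof. by move=> fl; apply: ulimE; apply: cvg_near_cst. Qed.

Lemma ulim_eventually f l : f @ \oo --> l -> ulim f = l.
Proof. by move=> fl; apply: ulimE => A /fl; exact: oU. Qed.

Lemma ulim_ge f (a : R) : U [set n | 0 <= f n <= 1] -> U [set n | a <= f n] ->
  a <= ulim f.
Proof. by move=> /ulim_cvg cf af; apply: limr_ge => //; apply: cvgP cf. Qed.

Variable B : Type.
Implicit Types (C D X : set (int -> B)) (mm : nat -> set (int -> B) -> R).

Definition content_ulim mm C := ulim (mm ^~ C).

Lemma content_bounded mm C :
  U [set n | prob_content (mm n)] -> cylset C -> U [set n | 0 <= mm n C <= 1].
Proof.
move=> Umm cC; apply: filterS Umm => n pm /=.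
by rewrite (content_ge0 pm cC) (content_le1 pm cC).
Qed.

Lemma content_ulim_cvg mm C :
  U [set n | prob_content (mm n)] -> cylset C ->
  mm ^~ C @ U --> content_ulim mm C.
Proof. by move=> Umm cC; apply/ulim_cvg/content_bounded. Qed.

Lemma content_ulim_prob mm :
  U [set n | prob_content (mm n)] -> prob_content (content_ulim mm).
Proof.
move=> Umm; split.
- move=> C cC; apply: ulim_ge; first exact: content_bounded.
  by apply: filterS Umm => n pm; exact: (content_ge0 pm cC).
- move=> C D cC cD CD; apply: ulimE.
  have cCD : (fun n => mm n C + mm n D) @ U -->
      content_ulim mm C + content_ulim mm D.
    by apply: cvgD; exact: content_ulim_cvg.
  apply: cvg_trans cCD; apply: near_eq_cvg.
  by apply: filterS Umm => n pm; rewrite (content_additive pm).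
- apply: ulim_near_cst.
  by apply: filterS Umm => n pm; exact: (content_setT pm).
Qed.

(** Only asymptotic invariance is assumed, because empirical contents are
    invariant up to a boundary term. *)
Lemma content_ulim_shift mm C :
  U [set n | prob_content (mm n)] -> cylset C ->
  (fun n => mm n (@translate B @^-1` C) - mm n C) @ U --> 0 ->
  content_ulim mm (@translate B @^-1` C) = content_ulim mm C.
Proof.
move=> Umm cC m0; apply: ulimE.
have cCD : (fun n => mm n (@translate B @^-1` C) - mm n C + mm n C) @ U -->
    0 + content_ulim mm C by apply: cvgD => //; exact: content_ulim_cvg.
rewrite add0r in cCD; apply: cvg_trans cCD; apply: near_eq_cvg.
by apply: nearW => n /=; rewrite subrK.
Qed.

(** A substitute for closedness in the product topology that only speaks of
    sequences. *)
Definition ultraclosed (S : set (set (int -> B) -> R)) := forall mm,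
  U [set n | S (mm n)] -> S (content_ulim mm).

Lemma inv_content_ultraclosed X : ultraclosed (inv_content X).
Proof.
move=> mm Umm.
have Upm : U [set n | prob_content (mm n)] by apply: filterS Umm => n [].
split.
- exact: content_ulim_prob.
- move=> C cC; apply: content_ulim_shift => //.
  apply: cvg_near_cst.
  by apply: filterS Umm => n [_ + _] /= => ->//; rewrite subrr.
- by move=> C cC CX; apply: ulim_near_cst; apply: filterS Umm => n [_ _]; exact.
Qed.

(** A limit along [U] of a maximising sequence is a maximiser. *)
Lemma ultraclosed_max S C : S !=set0 -> ultraclosed S ->
  S `<=` @prob_content R B -> cylset C ->
  exists2 m, S m & forall m', S m' -> m' C <= m C.
Proof.
move=> [m0 Sm0] clS Sp cC.
pose V := [set m C | m in S].
have hV : has_sup V.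
  split; first by exists (m0 C), m0.
  by exists 1 => _ [m Sm <-]; exact: (content_le1 (Sp _ Sm) cC).
have /choice[mm mmP] (n : nat) : exists m, S m /\ sup V - n.+1%:R^-1 < m C.
  have n0 : 0 < n.+1%:R^-1 :> R by rewrite invr_gt0.
  by have [_ [m Sm <-] mC] := sup_adherent n0 hV; exists m.
have Umm : U [set n | S (mm n)] by apply: nearW => n; have [] := mmP n.
exists (content_ulim mm); first exact: clS.
move=> m' Sm'; have -> : content_ulim mm C = sup V.
  apply: ulim_eventually; apply: (@squeeze_cvgr _ _ _ _
    (fun n => sup V - n.+1%:R^-1) (fun=> sup V)).
  - apply: nearW => n; have [Smn /ltW ->] := mmP n => /=.
    by apply: ub_le_sup; [exact: hV.2|exists (mm n)].
  - rewrite -[X in _ --> X]subr0; apply: cvgB; first exact: cvg_cst.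
    exact: cvg_harmonic.
  - exact: cvg_cst.
by apply: ub_le_sup; [exact: hV.2|exists m'].
Qed.

End Ultralimit.

(** * Extreme invariant contents *)
Section ExtremeContents.
Variables (R : realType) (B : finType) (X : set (int -> B)).
Implicit Types (C D : set (int -> B)) (m : set (int -> B) -> R).

Definition extreme_content m := inv_content X m /\
  forall t m1 m2, 0 < t < 1 -> inv_content X m1 -> inv_content X m2 ->
    (forall C, cylset C -> m C = t * m1 C + (1 - t) * m2 C) ->
    forall C, cylset C -> m1 C = m C.

(** A pair of a window and a finite list of admissible words: a countable type
    that codes all cylinder sets. *)
Definition cylset_of (d : seq int * seq (seq B)) : set (int -> B) :=
  [set x | [seq x i | i <- d.1] \in d.2].

Lemma cylset_of_cylset d : cylset (cylset_of d).
Proof.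
exists d.1 => x y xy; rewrite /cylset_of /=.
suff -> : [seq y i | i <- d.1] = [seq x i | i <- d.1] by [].
by apply/eq_in_map => i /xy.
Qed.

Lemma cylset_ofP C : cylset C -> exists d, cylset_of d = C.
Proof.
move=> [s dC].
pose L := [seq tval w | w <-
  [seq w : (size s).-tuple B <- enum {: (size s).-tuple B} |
  `[< exists2 x, C x & [seq x i | i <- s] = w >]]].
exists (s, L); apply/seteqP; split=> x; rewrite /cylset_of /=.
  move=> /mapP[w]; rewrite mem_filter => /andP[/asboolP[y Cy yw] _] xw.
  apply: dC Cy; apply/eq_in_map.
  by rewrite xw yw.
move=> Cx; apply/mapP; exists (map_tuple x (in_tuple s)) => //.
by rewrite mem_filter mem_enum andbT; apply/asboolP; exists x.
Qed.

Variable D : set (int -> B).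
Hypothesis cD : cylset D.

(** The set [D] comes first so that its value is maximised before all others;
    afterwards come all cylinder sets. *)
Definition cylset_seq (j : nat) : set (int -> B) :=
  if j is j'.+1 then
    if unpickle j' is Some d then cylset_of d else set0
  else D.

Lemma cylset_seq_cylset j : cylset (cylset_seq j).
Proof.
case: j => [//|j] /=; case: unpickle => [d|]; first exact: cylset_of_cylset.
exact: cylset0.
Qed.

Lemma cylset_seqP C : cylset C -> exists j, cylset_seq j = C.
Proof.
by move=> /cylset_ofP[d <-]; exists (pickle d).+1; rewrite /= pickleK.
Qed.

(** Nested faces of the convex set of invariant contents: each step keeps the
    maximisers of the next cylinder set. *)
Fixpoint lexface (j : nat) : set (set (int -> B) -> R) :=
  if j is j'.+1 then
    [set m | lexface j' m /\
      forall m', lexface j' m' -> m' (cylset_seq j') <= m (cylset_seq j')]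
  else inv_content X.

Lemma lexface_sub i j : (i <= j)%N -> lexface j `<=` lexface i.
Proof.
by move=> /subnK <-; elim: (j - i)%N => [|k IH] //= m [/IH].
Qed.

Lemma lexface_inv j : lexface j `<=` inv_content X.
Proof. exact: (@lexface_sub 0). Qed.

Lemma lexface_prob j : lexface j `<=` @prob_content R B.
Proof. by move=> m /lexface_inv[]. Qed.

(** The faces are non-empty and closed under ultrafilter limits, so they have a
    common point [m]. If [m] is a proper mixture of two invariant contents, both
    lie in every face, hence both agree with [m] on every cylinder set. *)
Lemma extreme_content_exists m0 : inv_content X m0 ->
  exists2 m, extreme_content m & m0 D <= m D.
Proof.
move=> im0; have [U [UU oU]] : exists U, UltraFilter U /\ \oo `<=` U.
  by have [U ? ?] := free_ultrafilter; exists U.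
have cl j : ultraclosed U (lexface j).
  elim: j => [|j IH] /=; first exact: inv_content_ultraclosed.
  move=> mm Umm; split; first by apply: IH; apply: filterS Umm => n [].
  move=> m' fm'; apply: ulim_ge.
    apply: content_bounded; last exact: cylset_seq_cylset.
    by apply: filterS Umm => n [/lexface_prob].
  by apply: filterS Umm => n [_]; exact.
have face0 j : lexface j !=set0.
  elim: j => [|j IH] /=; first by exists m0.
  have [m fm mmax] := ultraclosed_max UU oU IH (cl j) (@lexface_prob j)
    (cylset_seq_cylset j).
  by exists m.
have /choice[mm mmP] := face0.
pose m := content_ulim U mm.
have fm j : lexface j m.
  apply: cl; apply: oU; exists j => // n jn.
  exact: (lexface_sub jn (mmP n)).
exists m; last by have [_] := fm 1; apply.
split; first exact: (fm 0%N).
move=> t m1 m2 /andP[t0 t1] i1 i2 mE C /cylset_seqP[j <-].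
have fm12 k : lexface k m1 /\ lexface k m2.
  elim: k => [|k [f1 f2]] //=.
  have [_ mmax] := fm k.+1.
  have [e1 e2] : m1 (cylset_seq k) = m (cylset_seq k) /\
      m2 (cylset_seq k) = m (cylset_seq k).
    have := mE _ (cylset_seq_cylset k); have := mmax _ f1; have := mmax _ f2.
    move: (m _) (m1 _) (m2 _) => a a1 a2 a2a a1a aE.
    by split; nra.
  by rewrite /= e1 e2.
apply/eqP; rewrite eq_le; have [f1 _] := fm12 j.
have [_ ->//] := fm j.+1; have [_ h] := (fm12 j.+1).1; apply: h; exact: fm.
Qed.

End ExtremeContents.

(** * Averaging over independent coin tosses *)
Section CoinMean.
Variables (R : realType) (p : R).
Hypothesis p01 : 0 <= p <= 1.
Implicit Types (f g : (int -> bool) -> R) (v w : int -> bool) (l s : seq int).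

Definition upd v i b : int -> bool := fun j => if j == i then b else v j.

(** The mean of [f] when the coins at the positions in [l] are tossed
    independently, each true with probability [p], and the other coins are as
    in [v]. *)
Fixpoint coinmean l f v : R :=
  if l is i :: l' then
    p * coinmean l' f (upd v i true) + (1 - p) * coinmean l' f (upd v i false)
  else f v.

Definition depends (T : Type) s (f : (int -> bool) -> T) :=
  forall v w, (forall i, i \in s -> v i = w i) -> f v = f w.

Lemma updC v i j a b : i != j -> upd (upd v i a) j b = upd (upd v j b) i a.
Proof.
move=> ij; apply/funext => k; rewrite /upd.
by case: eqP => // ->; rewrite eq_sym (negbTE ij).
Qed.

Lemma coinmean_cst l c v : coinmean l (fun=> c) v = c.
Proof. by elim: l v => [//|i l IH] v /=; rewrite !IH; ring. Qed.

Lemma coinmeanD l f g v :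
  coinmean l (fun w => f w + g w) v = coinmean l f v + coinmean l g v.
Proof. by elim: l v => [//|i l IH] v /=; rewrite !IH; ring. Qed.

Lemma coinmeanZ l c f v : coinmean l (fun w => c * f w) v = c * coinmean l f v.
Proof. by elim: l v => [//|i l IH] v /=; rewrite !IH; ring. Qed.

Lemma coinmean_ge0 l f v : (forall w, 0 <= f w) -> 0 <= coinmean l f v.
Proof.
have /andP[p0 p1] := p01.
move=> f0; elim: l v => [//|i l IH] v /=.
by rewrite addr_ge0// mulr_ge0// subr_ge0.
Qed.

Lemma coinmean_cat l1 l2 f v :
  coinmean (l1 ++ l2) f v = coinmean l1 (coinmean l2 f) v.
Proof. by elim: l1 v => [//|i l IH] v /=; rewrite !IH. Qed.

Lemma coinmean_upd l f v i b : i \notin l ->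
  coinmean l f (upd v i b) = coinmean l (fun w => f (upd w i b)) v.
Proof.
elim: l v => [//|j l IH] v; rewrite inE negb_or => /andP[ij il] /=.
by rewrite !(updC v _ _ ij) !IH.
Qed.

Lemma coinmean_exchange l1 l2 f v : ~~ has (mem l2) l1 ->
  coinmean l1 (coinmean l2 f) v = coinmean l2 (coinmean l1 f) v.
Proof.
elim: l1 v => [//|i l IH] v /=; rewrite negb_or => /andP[il2 ll2].
by rewrite !IH// !coinmean_upd// -!coinmeanZ -coinmeanD.
Qed.

Lemma coinmean_perm l l' f v : uniq l -> perm_eq l l' ->
  coinmean l f v = coinmean l' f v.
Proof.
move=> ul ll'; suff : uniq l' -> coinmean l' f v = coinmean l f v.
  by move=> ->//; rewrite -(perm_uniq ll').
apply: (@catCA_perm_ind _ (fun l' => uniq l' -> coinmean l' f v = coinmean l f v))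
  ll' _ => // s1 s2 s3 IH u213.
rewrite -IH; last by rewrite uniq_catCA.
rewrite !catA !coinmean_cat coinmean_exchange//.
by move: u213; rewrite catA cat_uniq => /andP[]; rewrite cat_uniq has_sym => /and3P[].
Qed.

Lemma coinmean_depends s l f v w : depends s f ->
  (forall i, i \in s -> i \notin l -> v i = w i) ->
  coinmean l f v = coinmean l f w.
Proof.
move=> df; elim: l v w => [|i l IH] v w vw /=; first by apply: df => i si; exact: vw.
have upd_eq b : coinmean l f (upd v i b) = coinmean l f (upd w i b).
  apply: IH => j js jl; rewrite /upd; case: eqP => // ji.
  by apply: vw => //; rewrite inE negb_or jl andbT; apply/eqP.
by rewrite !upd_eq.
Qed.

Lemma coinmean_filter s l f v : depends s f ->
  coinmean l f v = coinmean [seq i <- l | i \in s] f v.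
Proof.
move=> df; elim: l v => [//|i l IH] v /=; case: ifPn => si /=; first by rewrite !IH.
have upd_eq b : coinmean l f (upd v i b) = coinmean l f v.
  apply: (coinmean_depends df) => j js _; rewrite /upd; case: eqP => // ji.
  by rewrite -ji js in si.
by rewrite !upd_eq -IH; ring.
Qed.

(** A function of finitely many coins has the same mean over every window that
    contains them; this makes the joint content below well defined. *)
Lemma coinmean_window s l l' f v w : depends s f -> uniq l -> uniq l' ->
  {subset s <= l} -> {subset s <= l'} -> coinmean l f v = coinmean l' f w.
Proof.
move=> df ul ul' sl sl'.
rewrite (@coinmean_depends s l f v w)//; last by move=> i /sl ->.
rewrite (coinmean_filter l _ df) (coinmean_filter l' _ df).
apply: coinmean_perm; first exact: filter_uniq.
apply: uniq_perm; rewrite ?filter_uniq// => i; rewrite !mem_filter.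
by case si : (i \in s) => //=; rewrite sl// sl'.
Qed.

(** Coins that do not influence [f] can be averaged independently of it. *)
Lemma coinmean_mull s l f g v : depends s f -> ~~ has (mem s) l ->
  coinmean l (fun w => f w * g w) v = f v * coinmean l g v.
Proof.
move=> df; elim: l v => [//|i l IH] v /=; rewrite negb_or => /andP[si sl].
have upd_eq b : f (upd v i b) = f v.
  by apply: df => j sj; rewrite /upd; case: eqP => // ji; rewrite -ji sj in si.
by rewrite !IH// !upd_eq; ring.
Qed.

Lemma coinmean_translate l f v :
  coinmean [seq i + 1 | i <- l] (f \o @translate bool) v =
  coinmean l f (translate v).
Proof.
elim: l v => [//|i l IH] v /=; rewrite !IH.
have updT b : translate (upd v (i + 1) b) = upd (translate v) i b.
  by apply/funext => j; rewrite /translate /upd (inj_eq (addIr 1)).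
by rewrite !updT.
Qed.

End CoinMean.

(** * The joint law of a random point and the coins *)
Section JointContent.
Variables (R : realType) (A : Type) (p : R).
Hypothesis p01 : 0 <= p <= 1.
Implicit Types (x : int -> A * bool) (y : int -> A) (w : int -> bool).
Implicit Types (C D : set (int -> A * bool)).

Definition base x : int -> A := fun i => (x i).1.
Definition coin x : int -> bool := fun i => (x i).2.
Definition pairing y w : int -> A * bool := fun i => (y i, w i).

Lemma pairing_eta x : pairing (base x) (coin x) = x.
Proof. by apply/funext => i; rewrite /pairing /base /coin -surjective_pairing. Qed.

Definition section C w : set (int -> A) := [set y | C (pairing y w)].

Lemma cylset_section C w : cylset C -> cylset (section C w).
Proof.
move=> [s dC]; exists s => y z yz; apply: dC => i si.
by rewrite /pairing yz.
Qed.

Lemma section_depends s C : determined s C -> depends s (section C).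
Proof.
move=> dC v w vw; apply/seteqP; split=> y Cy; apply: dC Cy => i si.
  by rewrite /pairing vw.
by rewrite /pairing vw.
Qed.

Lemma cylset_base (E : set (int -> A)) : cylset E -> cylset (base @^-1` E).
Proof.
by move=> [s dE]; exists s => x y xy; apply: dE => i si; rewrite /base xy.
Qed.

Lemma cylset_coin (V : set (int -> bool)) : cylset V -> cylset (coin @^-1` V).
Proof.
by move=> [s dV]; exists s => x y xy; apply: dV => i si; rewrite /coin xy.
Qed.

Variables (X : set (int -> A)) (m : set (int -> A) -> R).
Hypothesis im : inv_content X m.
Let pm : prob_content m := inv_content_prob im.

Let secm C w := m (section C w).

(** Average over the coins of the content [m] of the section. The window is any
    finite set of coins on which this content depends; by [coinmean_window] the
    result is the same for all such sets and all values of the other coins. *)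
Definition joint_content C : R :=
  coinmean p (undup (xget [::] [set s | depends s (secm C)])) (secm C) (fun=> false).

Lemma secm_depends s C : depends s (section C) -> depends s (secm C).
Proof. by move=> dC v w /dC; rewrite /secm => ->. Qed.

Lemma cylset_secm C : cylset C -> exists s, depends s (secm C).
Proof. by move=> [s /section_depends/secm_depends dC]; exists s. Qed.

Lemma joint_contentE s C l v : depends s (secm C) -> uniq l -> {subset s <= l} ->
  joint_content C = coinmean p l (secm C) v.
Proof.
move=> dC ul sl; rewrite /joint_content; case: xgetP => [t _ dt|/(_ s)//].
pose u := undup (s ++ t).
have uu : uniq u := undup_uniq _.
have su : {subset s <= u} by move=> i si; rewrite mem_undup mem_cat si.
have tu : {subset t <= u} by move=> i ti; rewrite mem_undup mem_cat ti orbT.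
transitivity (coinmean p u (secm C) v).
  apply: (coinmean_window p _ _ dt) => //; first exact: undup_uniq.
  by move=> i; rewrite mem_undup.
exact: (coinmean_window p _ _ dC).
Qed.

Lemma joint_content_depends s C : depends s (secm C) ->
  forall v, joint_content C = coinmean p (undup s) (secm C) v.
Proof.
move=> dC v; apply: (joint_contentE v dC); first exact: undup_uniq.
by move=> i; rewrite mem_undup.
Qed.

Lemma joint_content_base (E : set (int -> A)) : joint_content (base @^-1` E) = m E.
Proof. by rewrite (@joint_content_depends [::] _ _ (fun=> false)). Qed.

Lemma joint_content_prob : prob_content joint_content.
Proof.
split.
- move=> C cC; have [s dC] := cylset_secm cC.
  rewrite (joint_content_depends dC (fun=> false)) coinmean_ge0// => w.
  by apply: (content_ge0 pm); exact: cylset_section.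
- move=> C D cC cD CD; have [s dC] := cylset_secm cC.
  have [t dD] := cylset_secm cD.
  have secU w : secm (C `|` D) w = secm C w + secm D w.
    rewrite /secm -(content_additive pm) //; try exact: cylset_section.
    rewrite -subset0 => y [Cy Dy].
    by have : (C `&` D) (pairing y w) by []; rewrite CD.
  pose u := undup (s ++ t).
  have uu : uniq u := undup_uniq _.
  have su : {subset s <= u} by move=> i si; rewrite mem_undup mem_cat si.
  have tu : {subset t <= u} by move=> i ti; rewrite mem_undup mem_cat ti orbT.
  pose v := (fun=> false) : int -> bool.
  rewrite (joint_contentE v dC uu su) (joint_contentE v dD uu tu) -coinmeanD.
  have dU : depends u (secm (C `|` D)).
    move=> a b ab; rewrite !secU; congr (_ + _).
      by apply: dC => i /su; exact: ab.
    by apply: dD => i /tu; exact: ab.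
  rewrite (joint_contentE v dU uu)//; congr (coinmean p u _ v).
  by apply/funext => w; exact: secU.
- by rewrite (joint_content_base setT) (content_setT pm).
Qed.

(** Translating the coins translates the window of the average, and translating
    the sections is harmless because [m] is invariant. *)
Lemma joint_content_shift : shift_invariant_content joint_content.
Proof.
move=> C cC; have [s sC] := cC; have dC := secm_depends (section_depends sC).
have dTC := secm_depends (section_depends (determined_translate sC)).
pose v := (fun=> false) : int -> bool.
rewrite (@joint_contentE _ _ [seq i + 1 | i <- undup s] v dTC); last 2 first.
- by rewrite map_inj_uniq ?undup_uniq//; exact: addIr.
- by move=> i /mapP[j js ->]; apply/mapP; exists j => //; rewrite mem_undup.
rewrite (joint_content_depends dC (translate v)) -coinmean_translate.
congr (coinmean p _ _ v); apply/funext => w; rewrite /secm /=.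
rewrite -(inv_content_shift im (cylset_section (translate w) cC)).
by [].
Qed.

(** The event [C] may depend on arbitrarily many coordinates of the point; only
    the coins that it reads must avoid [t]. *)
Lemma joint_content_independent s t C (V : set (int -> bool)) :
  depends s (section C) -> determined t V -> ~~ has (mem s) t ->
  joint_content (C `&` coin @^-1` V) =
  joint_content C * joint_content (coin @^-1` V).
Proof.
move=> dC dV st; pose v := (fun=> false) : int -> bool.
have secV w : secm (coin @^-1` V) w = if `[< V w >] then 1 else 0.
  rewrite /secm; case: asboolP => Vw.
    by rewrite -(content_setT pm); congr m; apply/seteqP; split.
  by rewrite -(content0 pm); congr m; apply/seteqP; split.
have secCV w : secm (C `&` coin @^-1` V) w = secm C w * secm (coin @^-1` V) w.
  rewrite secV /secm; case: asboolP => Vw.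
    by rewrite mulr1; congr m; apply/seteqP; split=> [y []|y].
  by rewrite mulr0 -(content0 pm); congr m; apply/seteqP; split=> [y []|y].
have dsV : depends t (secm (coin @^-1` V)).
  move=> a b ab; rewrite !secV; congr (if _ then _ else _).
  apply/asbool_equiv_eq; split; apply: dV => i it; first exact: ab.
  by rewrite ab.
have dsC := secm_depends dC.
have dCV : depends (s ++ t) (secm (C `&` coin @^-1` V)).
  move=> a b ab; rewrite !secCV; congr (_ * _).
    by apply: dsC => i si; apply: ab; rewrite mem_cat si.
  by apply: dsV => i it; apply: ab; rewrite mem_cat it orbT.
have st' : ~~ has (mem s) (undup t).
  by apply: contra st => /hasP[i]; rewrite mem_undup => it si; apply/hasP; exists i.
rewrite (@joint_contentE _ _ (undup s ++ undup t) v dCV); last 2 first.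
- rewrite cat_uniq !undup_uniq andbT /=; apply: contra st' => /hasP[i it].
  by rewrite /= mem_undup => si; apply/hasP; exists i.
- by move=> i; rewrite !mem_cat !mem_undup.
rewrite coinmean_cat (joint_content_depends dsC v) mulrC -coinmeanZ.
congr (coinmean p _ _ v); apply/funext => w.
rewrite (joint_content_depends dsV w) mulrC -(coinmean_mull _ _ _ dsC st').
by congr (coinmean p _ _ w); apply/funext => w'; exact: secCV.
Qed.

End JointContent.

(** * Ergodicity of the joint law *)
Section FarTranslates.
Variable B : Type.

Lemma iter_translate k (x : int -> B) i : iter k (@translate B) x i = x (i + k%:Z).
Proof.
elim: k i => [|k IH] i /=; first by rewrite addr0.
by rewrite /translate IH -addrA -intS.
Qed.

Lemma determined_iter_translate s (C : set (int -> B)) k : determined s C ->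
  determined [seq i + k%:Z | i <- s] (iter k (@translate B) @^-1` C).
Proof.
move=> dC x y xy; apply: dC => i si; rewrite !iter_translate; apply: xy.
exact: map_f.
Qed.

Lemma cylset_iter_translate (C : set (int -> B)) k : cylset C ->
  cylset (iter k (@translate B) @^-1` C).
Proof.
move=> [s dC]; exists [seq i + k%:Z | i <- s]; exact: determined_iter_translate.
Qed.

Lemma translate_disjoint (s t : seq int) :
  exists k : nat, ~~ has (mem s) [seq i + k%:Z | i <- t].
Proof.
have bound (r : seq int) : exists N : nat, forall i, i \in r -> `|i| <= N%:Z.
  elim: r => [|j r [N rN]]; first by exists 0%N.
  exists (N + absz j)%N => i; rewrite inE => /predU1P[->|/rN]; lia.
have [N sN] := bound s; have [M tM] := bound t.
exists (N + M).+1; apply/hasP => -[_ /mapP[j tj ->] sj].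
have := sN _ sj; have := tM _ tj; lia.
Qed.

End FarTranslates.

Section JointMeasure.
Variables (R : realType) (n : nat) (p : R).
Hypothesis p01 : 0 <= p <= 1.
Local Notation A := (alphabet n).
Local Notation seqs := (g_sigma_algebraType (@cylset (A * bool))).
Variables (X : set (int -> A)) (m : set (int -> A) -> R).
Hypothesis em : extreme_content X m.
Let im : inv_content X m := em.1.
Local Notation lam := (joint_content p m).

Variable P : probability seqs R.
Hypothesis PE : forall C, cylset C -> P C = (lam C)%:E.

Let probPE C : cylset C -> prob P C = lam C.
Proof. by move=> cC; rewrite /prob PE. Qed.

Let P_translate (G : set seqs) : measurable G ->
  prob P (@translate (A * bool) @^-1` G) = prob P G.
Proof.
move=> mG; rewrite /prob (@translate_invariant _ R P lam) => //.
exact: (joint_content_shift p im).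
Qed.

Let mtr k (G : set seqs) : measurable G ->
  measurable (iter k (@translate (A * bool)) @^-1` G : set seqs).
Proof.
elim: k G => [|k IH] G mG //; rewrite -[X in measurable X]setTI.
have -> : iter k.+1 (@translate (A * bool)) @^-1` G =
  iter k (@translate (A * bool)) @^-1` (@translate (A * bool) @^-1` G) by [].
rewrite setTI; apply: IH; rewrite -[X in measurable X]setTI.
exact: measurable_translate.
Qed.

Let P_iter_translate k (G : set seqs) : measurable G ->
  prob P (iter k (@translate (A * bool)) @^-1` G) = prob P G.
Proof.
elim: k G => [|k IH] G mG //.
have -> : iter k.+1 (@translate (A * bool)) @^-1` G =
  iter k (@translate (A * bool)) @^-1` (@translate (A * bool) @^-1` G) by [].
by rewrite IH ?P_translate//; exact: (mtr 1).
Qed.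

Variable G : set seqs.
Hypotheses (mG : measurable G) (iG : @translate (A * bool) @^-1` G = G).

Let iGk k : iter k (@translate (A * bool)) @^-1` G = G.
Proof.
elim: k => [//|k IH].
by rewrite -[RHS]IH -[in RHS]iG.
Qed.

Let prob_translate_invariant k (C : set seqs) : cylset C ->
  prob P (G `&` C) = prob P (G `&` (iter k (@translate (A * bool)) @^-1` C)).
Proof.
move=> cC; rewrite -(P_iter_translate k); last first.
  by apply: measurableI => //; exact: cylset_measurable.
by rewrite preimage_setI iGk.
Qed.

(** Approximate [G] by a cylinder set and move [E] and [V] by a translation that
    takes the coins of [V] out of the window of that cylinder set; the
    translation changes neither side, since [G] is invariant. *)
Lemma joint_invariant_coin (E : set (int -> A)) (V : set (int -> bool)) :
  cylset E -> cylset V ->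
  prob P (G `&` (@base A @^-1` E `&` @coin A @^-1` V)) =
  prob P (G `&` (@base A @^-1` E)) * lam (@coin A @^-1` V).
Proof.
move=> cE cV; apply/eqP; rewrite -subr_eq0 -normr_le0.
apply/ler_addgt0Pr => e e0; rewrite add0r.
have e2 : 0 < e / 2 by lra.
have [C cC CG] := cylset_dense P mG e2.
have [s dC] := cC; have [t dV] := cV.
have [k stk] := translate_disjoint s t.
pose Ek := @base A @^-1` (iter k (@translate A) @^-1` E).
pose Vk := iter k (@translate bool) @^-1` V.
have cEk : cylset Ek by apply/cylset_base/cylset_iter_translate.
have cVk : cylset Vk by exact: cylset_iter_translate.
have cV' : cylset (@coin A @^-1` V) by exact: cylset_coin.
have EkE : iter k (@translate (A * bool)) @^-1` (@base A @^-1` E) = Ek.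
  apply/seteqP; split=> x; rewrite /Ek /=; congr E; apply/funext => i;
  by rewrite /base !iter_translate.
have VkE : iter k (@translate (A * bool)) @^-1` (@coin A @^-1` V) = @coin A @^-1` Vk.
  apply/seteqP; split=> x; rewrite /Vk /=; congr V; apply/funext => i;
  by rewrite /coin !iter_translate.
have lamVk : lam (@coin A @^-1` Vk) = lam (@coin A @^-1` V).
  rewrite -!probPE//; last exact: cylset_coin.
  by rewrite -VkE P_iter_translate//; exact: cylset_measurable.
rewrite (prob_translate_invariant k); last by apply: cylsetI => //; exact: cylset_base.
rewrite preimage_setI EkE VkE (prob_translate_invariant k (cylset_base cE)) EkE.
have indep : prob P (C `&` (Ek `&` @coin A @^-1` Vk)) =
    prob P (C `&` Ek) * lam (@coin A @^-1` V).
  rewrite setIA !probPE; last 2 first.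
  - exact: cylsetI.
  - by apply: cylsetI; [exact: cylsetI|exact: cylset_coin].
  have dVk := determined_iter_translate (k := k) dV.
  rewrite -lamVk (joint_content_independent p im (s := s) _ dVk stk)//.
  move=> v w vw; have := section_depends dC vw => Cvw.
  apply/seteqP; split=> y [Cy Ey]; split=> //.
    by have : section C w y by rewrite -Cvw.
  by have : section C v y by rewrite Cvw.
have mC := cylset_measurable cC.
have mEk : measurable (Ek : set seqs) by exact: cylset_measurable.
have mEVk : measurable (Ek `&` @coin A @^-1` Vk : set seqs).
  by apply: cylset_measurable; apply: cylsetI => //; exact: cylset_coin.
have d1 := prob_symdiff P mG mC mEVk.
have d2 := prob_symdiff P mG mC mEk.
have pj := joint_content_prob p01 im.
have b0 := content_ge0 pj cV'; have b1 := content_le1 pj cV'.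
move: d1 d2 indep b0 b1.
move: (prob P (G `&` (Ek `&` _))) (prob P (C `&` (Ek `&` _))) (lam _).
move: (prob P (G `&` Ek)) (prob P (C `&` Ek)) => a c g h b d1 d2 hE b0 b1.
rewrite hE in d1.
rewrite (le_trans (ler_distD (c * b) _ _))// -mulrBl normrM (ger0_norm b0).
rewrite [leRHS]splitr lerD//; first by rewrite ltW// (le_lt_trans _ CG).
rewrite ltW// (le_lt_trans _ CG)// (le_trans _ d2)// distrC.
by rewrite -[leRHS]mulr1 ler_wpM2l.
Qed.

(** Conditioning on [G] or on its complement gives invariant contents on [X], so
    the extremality of [m] makes [G] independent of the point; with
    [joint_invariant_coin] it becomes independent of every cylinder set. *)
Lemma joint_ergodic : prob P G = 0 \/ prob P G = 1.
Proof.
set c := prob P G.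
have [->|c0] := eqVneq c 0; first by left.
have [->|c1] := eqVneq c 1; first by right.
have [pj sj] := (joint_content_prob p01 im, (joint_content_shift p im)).
have c01 : 0 < c < 1.
  rewrite lt_neqAle eq_sym c0 prob_ge0 lt_neqAle c1 -(prob_setT P).
  by apply: le_prob => //.
have mGC : measurable (~` G) by exact: measurableC.
have mbase (E : set (int -> A)) : cylset E -> measurable (@base A @^-1` E : set seqs).
  by move=> cE; apply: cylset_measurable; exact: cylset_base.
have inv_piece (H : set seqs) : measurable H -> prob P H != 0 ->
    @translate (A * bool) @^-1` H = H ->
    inv_content X (fun E => prob P (H `&` @base A @^-1` E) / prob P H).
  move=> mH H0 iH; split.
  - split.
    + by move=> E cE; rewrite divr_ge0// prob_ge0.
    + move=> E F cE cF EF; rewrite -mulrDl -probU; first by rewrite -setIUr.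
      * by apply: measurableI => //; exact: mbase.
      * by apply: measurableI => //; exact: mbase.
      * rewrite -subset0 => x [[_ Ex] [_ Fx]].
        by have : (E `&` F) (base x) by []; rewrite EF.
    + by rewrite preimage_setT setIT divff.
  - move=> E cE; congr (_ / _).
    rewrite -(P_translate (measurableI _ _ mH (mbase _ cE))).
    by rewrite preimage_setI iH.
  - move=> E cE EX; have : prob P (H `&` @base A @^-1` E) <= 0; last first.
      by move=> h; apply/eqP; rewrite mulf_eq0 eq_le h prob_ge0.
    rewrite -(inv_content_support im cE EX) -(joint_content_base p m E).
    rewrite -probPE; last exact: cylset_base.
    apply: le_prob; [|exact: mbase|by move=> x []].
    by apply: measurableI => //; exact: mbase.
have probGC : prob P (~` G) = 1 - c by exact: probC.
(* Extremality: the laws of the point given G and given its complement average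
   to m. *)
have base_indep (E : set (int -> A)) : cylset E ->
    prob P (G `&` @base A @^-1` E) = c * m E.
  have c1' : 1 - c != 0 by rewrite subr_eq0 eq_sym.
  have i1 := inv_piece G mG c0 iG.
  have i2 : inv_content X
      (fun E => prob P (~` G `&` @base A @^-1` E) / prob P (~` G)).
    by apply: inv_piece => //; rewrite ?probGC// -preimage_setC iG.
  move=> cE; rewrite -(em.2 c _ _ c01 i1 i2 _ E cE).
    by rewrite mulrC divfK.
  move=> F cF; rewrite probGC [c * _]mulrC divfK// [(1 - c) * _]mulrC divfK//.
  rewrite ![_ `&` (@base A @^-1` F)]setIC -(joint_content_base p m F) -probPE.
    by rewrite (prob_split P (mbase _ cF) mG).
  exact: cylset_base.
(* Split E according to the coins that it reads, one at a time; once no coin is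
   left, E only restricts the point and the event is a rectangle. *)
have cyl_indep s (E : set (int -> A * bool)) V : cylset E -> cylset V ->
    depends s (section E) ->
    prob P (G `&` (E `&` @coin A @^-1` V)) = c * lam (E `&` @coin A @^-1` V).
  elim: s E V => [|i s IH] E V cE cV dE.
    have EE : E = @base A @^-1` (section E (fun=> false)).
      apply/seteqP; split=> x; rewrite -{1}[x]pairing_eta => Ex.
        by have : section E (coin x) (base x) by []; rewrite (dE _ (fun=> false)).
      have : section E (coin x) (base x) by rewrite (dE _ (fun=> false)).
      by rewrite /section /= pairing_eta.
    have cE0 := cylset_section (fun=> false) cE.
    rewrite EE joint_invariant_coin// base_indep// -mulrA; congr (_ * _).
    rewrite (joint_content_independent p im (s := [::]) (t := projT1 (cid cV)))//.
    - by rewrite joint_content_base.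
    - exact: projT2 (cid cV).
    - by apply/hasP => -[].
  pose Eb b : set (int -> A * bool) :=
    [set x | E (pairing (base x) (upd (coin x) i b))].
  pose Vb b := V `&` [set w | w i = b].
  have cEb b : cylset (Eb b).
    have [t dt] := cE; exists t => x y xy; apply: dt => j jt.
    by rewrite /pairing /base /coin /upd xy//; case: ifP => //; rewrite xy.
  have cVb b : cylset (Vb b).
    by apply: cylsetI => //; exact: (cylset_coord i [set b]).
  have dEb b : depends s (section (Eb b)).
    have secEb v : section (Eb b) v = section E (upd v i b) by [].
    move=> v w vw; rewrite !secEb; apply: dE => j.
    by rewrite inE /upd; case: eqP => [//|_ /=]; exact: vw.
  have cEVb b : cylset (Eb b `&` @coin A @^-1` Vb b).
    by apply: cylsetI => //; exact: cylset_coin.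
  have EV : E `&` @coin A @^-1` V = (Eb true `&` @coin A @^-1` Vb true) `|`
      (Eb false `&` @coin A @^-1` Vb false).
    have updK x : upd (coin x) i (coin x i) = coin x.
      by apply/funext => j; rewrite /upd; case: eqP => // ->.
    apply/seteqP; split=> x; rewrite /Eb /Vb /=.
      move=> [Ex Vx]; case xi : (coin x i); [left|right]; split=> //;
      by rewrite -xi updK pairing_eta.
    by case=> -[Ex [Vx xi]]; split=> //; move: Ex; rewrite -xi updK pairing_eta.
  have disj : (Eb true `&` @coin A @^-1` Vb true) `&`
      (Eb false `&` @coin A @^-1` Vb false) = set0.
    by rewrite -subset0 => x [[_ [_ /= xt]] [_ [_ /= xf]]]; rewrite xt in xf.
  rewrite EV setIUr probU.
  - by rewrite !IH// -mulrDr -(content_additive pj (cEVb true) (cEVb false) disj).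
  - by apply: measurableI => //; exact: cylset_measurable.
  - by apply: measurableI => //; exact: cylset_measurable.
  - by rewrite setIACA disj setI0.
have cG (E : set (int -> A * bool)) : cylset E -> prob P (G `&` E) = c * prob P E.
  move=> cE; have [s dE] := cE.
  have := @cyl_indep s E setT cE (cylsetT _) (section_depends dE).
  by rewrite preimage_setT setIT => ->; rewrite probPE.
(* Approximating G itself by cylinder sets gives c <= c * c, against 0 < c < 1. *)
suff : c <= c * c by move: c01 => /andP[] + +; nra.
apply/ler_addgt0Pr => e e0; have e2 : 0 < e / 2 by lra.
have [C cC CG] := cylset_dense P mG e2.
have mC := cylset_measurable cC.
have d1 := prob_symdiff_le P mG mC mG.
have d2 := prob_symdiff_le P mC mG measurableT.
rewrite setIid setIC cG// in d1.
rewrite !setIT symdiff_sym in d2.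
have [c00 c10] := andP c01.
move: d1 d2 CG; rewrite -/c; move: (prob P C) (prob P _) => a d; nra.
Qed.

End JointMeasure.

(** * Cylinder sets and the product topology *)
Section CylinderTopology.
Variable n : nat.
Local Notation A := (alphabet n).
Implicit Types (U : set (fullshift n)) (x y : fullshift n).

Definition window (k : nat) : seq int :=
  [seq Posz j | j <- iota 0 k] ++ [seq Negz j | j <- iota 0 k].

Lemma mem_window k i : (absz i < k)%N -> i \in window k.
Proof.
case: i => j /= jk; rewrite mem_cat; apply/orP.
  by left; apply/mapP; exists j => //; rewrite mem_iota.
by right; apply/mapP; exists j => //; rewrite mem_iota; exact: ltnW.
Qed.

Lemma cylset_open (C : set (fullshift n)) : cylset (C : set (int -> A)) -> open C.
Proof.
move=> [s dC]; rewrite openE => x Cx; rewrite /interior.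
have : nbhs x [set y : fullshift n | forall i, i \in s -> x i = y i].
  elim: s {dC} => [|i s IH]; first by apply: filterS filterT => y _ i.
  have xi : nbhs x [set y : fullshift n | y i = x i].
    exact: (@proj_continuous int (fun=> discrete_topology A) i x _
      (discrete_set1 (x i : discrete_topology A))).
  apply: filterS (filterI xi IH) => y [/= yi ys] j.
  by rewrite inE => /predU1P[->|/ys].
by apply: filterS => y xy; apply: dC Cx.
Qed.

Definition window_interior U k : set (fullshift n) :=
  [set x | forall y, (forall i, i \in window k -> x i = y i) -> U y].

Lemma window_interior_cylset U k : cylset (window_interior U k : set (int -> A)).
Proof.
exists (window k) => x y xy Ux z yz; apply: Ux => i ik.
by rewrite xy// yz.
Qed.

(** Otherwise some point of [U] would be the pointwise limit of points outside
    [U] that agree with it on larger and larger windows. *)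
Lemma open_bigcup_window U : open U -> U = \bigcup_k window_interior U k.
Proof.
move=> oU; apply/seteqP; split=> [x Ux|x [k _]]; last by apply.
apply: contrapT => nx.
have /choice[g gP] (k : nat) : exists y : fullshift n,
    (forall i, i \in window k -> x i = y i) /\ ~ U y.
  apply: contrapT => /forallNP ny; apply: nx; exists k => // y xy.
  by apply: contrapT => nUy; apply: (ny y).
have gx : g @ \oo --> x.
  apply/cvg_sup => i V [W] [[T] oT <-] Tx TV.
  apply: (filterS TV); rewrite nbhs_simpl; exists (absz i).+1 => // k /= ik.
  by have [<-//] := gP k; exact: mem_window.
have /gx : nbhs x U by exact: open_nbhs_nbhs.
by move=> [k _ /(_ k (leqnn k))]; have [] := gP k.
Qed.

End CylinderTopology.

(** * Thinned measures *)
Section UnitMeasure.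
Context d (T : measurableType d) (R : realType) (mu : {measure set T -> \bar R}).
Hypothesis mu1 : mu setT = 1%E.

Let nu : set T -> \bar R := mu.

HB.instance Definition _ := Measure.on nu.
HB.instance Definition _ := Measure_isProbability.Build _ _ _ nu mu1.

Lemma probability_of_measure : exists P : probability T R, forall C, P C = mu C.
Proof. by exists nu. Qed.

End UnitMeasure.

Section ThinnedMeasure.
Variables (R : realType) (n : nat) (a : alphabet n).
Local Notation A := (alphabet n).
Local Notation seqs := (g_sigma_algebraType (@cylset (A * bool))).

Definition thin (x : seqs) : borel n := fun i => if coin x i then base x i else a.

Lemma cylset_thin (C : set (int -> A)) : cylset C -> cylset (thin @^-1` C).
Proof.
move=> [s dC]; exists s => x y xy; apply: dC => i si.
by rewrite /thin /coin /base xy.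
Qed.

Lemma measurable_thin : measurable_fun setT thin.
Proof.
apply: (@measurability _ _ seqs (borel n) setT _ (@open (fullshift n))) => //.
move=> _ [U oU <-]; rewrite setTI (open_bigcup_window oU) preimage_bigcup.
apply: bigcupT_measurable => k; apply: cylset_measurable; apply: cylset_thin.
exact: window_interior_cylset.
Qed.

Variables (p : R) (X : set (fullshift n)) (m : set (int -> A) -> R).
Hypotheses (p01 : 0 <= p <= 1) (cX : closed X) (safe : safe_symbol X a).
Hypothesis em : extreme_content X m.
Let im : inv_content X m := em.1.
Local Notation lam := (joint_content p m).

Definition nonsafe : set (fullshift n) := [set x | x 0 <> a].

(** Thinning maps [X] into itself since [a] is safe, so every section of the
    preimage of [C] misses [X]. *)
Lemma joint_content_thin_support (C : set (int -> A)) :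
  cylset C -> C `&` X = set0 -> lam (thin @^-1` C) = 0.
Proof.
move=> cC CX; have [s dC] := cylset_thin cC.
rewrite (joint_content_depends p (secm_depends m (section_depends dC)) (fun=> false)).
rewrite -[RHS](coinmean_cst p (undup s) 0 (fun=> false)).
congr (coinmean p _ _ _); apply/funext => w.
apply: (inv_content_support im); first by apply: cylset_section; exact: cylset_thin.
rewrite -subset0 => y [Cy Xy].
have : (C `&` X) (thin (pairing y w)); last by rewrite CX.
split=> //; apply: (safe Xy) => i; rewrite /thin /coin /base /pairing /=.
by case: (w i); [left|right].
Qed.

Lemma joint_content_thin_nonsafe : lam (thin @^-1` nonsafe) = p * m nonsafe.
Proof.
have -> : thin @^-1` nonsafe =
    @base A @^-1` nonsafe `&` @coin A @^-1` [set w | w 0].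
  apply/seteqP; split=> x; rewrite /nonsafe /thin /=; case: (coin x 0) => /=.
  - by [].
  - by [].
  - by case.
  - by case.
rewrite (@joint_content_independent _ _ p X m im [::] [:: 0])//; last first.
  by move=> v w /(_ 0 (mem_head _ _)) /= ->.
rewrite joint_content_base mulrC; congr (_ * _).
have secE : (fun w => m (section (@coin A @^-1` [set w | w 0]) w)) =
    fun w => if w 0 then 1 else 0.
  apply/funext => w; case w0 : (w 0).
    by rewrite -(content_setT (inv_content_prob im)); congr m; apply/seteqP; split.
  rewrite -(content0 (inv_content_prob im)); congr m.
  by rewrite -subset0 => y; rewrite /section /coin /= w0.
rewrite (@joint_content_depends _ _ p m [:: 0] _ _ (fun=> false)) secE.
  by rewrite /= mulr1 mulr0 addr0.
by move=> v w /(_ 0 (mem_head _ _)) ->.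
Qed.

Lemma thinned_measure : exists2 nu : probability (borel n) R,
  ergodic_measures R X nu & nu nonsafe = (p * m nonsafe)%:E.
Proof.
have finAB : finite_set [set: A * bool] by exact: finite_finset.
have [P PE] := content_extension finAB (joint_content_prob p01 im).
pose N : {measure set (borel n) -> \bar R} :=
  measure_function_pushforward__canonical__measure_function_Measure P measurable_thin.
have NE (C : set (borel n)) : N C = P (thin @^-1` C) by [].
have N1 : N setT = 1%E by rewrite NE preimage_setT probability_setT.
have [nu nuN] := probability_of_measure N1.
have nuE (C : set (borel n)) : nu C = P (thin @^-1` C) by rewrite nuN.
have mthin (C : set (borel n)) : measurable C -> measurable (thin @^-1` C).
  by move=> mC; rewrite -[X in measurable X]setTI; exact: measurable_thin.
have cyl0 : cylset (nonsafe : set (int -> A)).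
  exact: (cylset_coord 0 [set b | b <> a]).
exists nu; last first.
  by rewrite nuE PE ?joint_content_thin_nonsafe//; exact: cylset_thin.
split.
- have oX : open (~` X) by exact: closed_openC.
  have mX : measurable (~` X : set (borel n)) by exact: sub_sigma_algebra.
  suff : nu (~` X) = 0%E.
    by move=> h; rewrite -[X]setCK probability_setC ?h ?sube0//.
  apply/eqP; rewrite eq_le measure_ge0 andbT nuE (open_bigcup_window oX) preimage_bigcup.
  have cW k : cylset (thin @^-1` window_interior (~` X) k).
    by apply: cylset_thin; exact: window_interior_cylset.
  apply: le_trans (measure_sigma_subadditive P _ _ (@subset_refl _ _)) _.
  - by move=> k; exact: cylset_measurable.
  - by apply: bigcupT_measurable => k; exact: cylset_measurable.
  rewrite eseries0// => k _ _; rewrite PE// joint_content_thin_support//.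
    exact: window_interior_cylset.
  by rewrite -subset0 => x [Wx Xx]; apply: (Wx x).
- move=> C mC; rewrite !nuE.
  rewrite -(translate_invariant (joint_content_shift p im) PE (mthin _ mC)).
  by [].
- move=> C mC iC; rewrite !nuE.
  have iG : @translate (A * bool) @^-1` (thin @^-1` C) = thin @^-1` C.
    by rewrite -[in RHS]iC.
  have mG := mthin _ mC.
  have := joint_ergodic p01 em PE mG iG.
  by rewrite (probE P mG) => -[->|->]; [left|right].
Qed.

End ThinnedMeasure.

(** * Entropy and the frequency of non-safe symbols *)

(** The limit is the infimum of [u k / k]: writing [N = q * k + r] with [r < k]
    bounds [u N] by [q * u k] up to a constant that does not depend on [N]. *)
Lemma fekete (R : realType) (u : nat -> R) : (forall k, 0 <= u k) ->
  (forall k l, u (k + l)%N <= u k + u l) -> cvgn (fun k => u k / k%:R).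
Proof.
move=> u0 usub.
have ulin k : u k <= u 0%N + k%:R * u 1%N.
  elim: k => [|k IH]; first by rewrite mul0r addr0.
  by rewrite -addn1 (le_trans (usub _ _))// natrD mulrDl mul1r addrA lerD2r.
have umul q k : u (q * k)%N <= q%:R * u k + u 0%N.
  elim: q => [|q IH]; first by rewrite mul0n mul0r add0r.
  by rewrite mulSn (le_trans (usub _ _))// mulrS mulrDl mul1r -addrA lerD2l.
pose V := [set u k.+1 / k.+1%:R | k in [set: nat]].
have hV : has_inf V.
  by split; [exists (u 1%N / 1), 0%N|exists 0 => _ [k _ <-]; rewrite divr_ge0].
pose L := inf V.
have Lle k : (0 < k)%N -> L <= u k / k%:R.
  by case: k => // k _; apply: ge_inf; [exact: hV.2|exists k].
apply/cvg_ex; exists L; apply/cvgrPdist_le => e e0.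
have e2 : 0 < e / 2 by lra.
have [_ [k _ <-] kL] := inf_adherent e2 hV.
pose C := u 0%N + (u 0%N + k.+1%:R * u 1%N).
have C0 : 0 <= C by rewrite !addr_ge0// mulr_ge0.
near=> N.
have N0 : (0 < N)%N by near: N; exists 1%N.
have N0' : 0 < N%:R :> R by rewrite ltr0n.
have CN : C / N%:R <= e / 2.
  rewrite ler_pdivrMr// mulrC -ler_pdivrMr//.
  by near: N; exact: nbhs_infty_ger.
rewrite distrC ger0_norm ?subr_ge0 ?Lle// lerBlDl.
have : u N <= (N %/ k.+1)%:R * u k.+1 + C.
  rewrite {1}(divn_eq N k.+1) (le_trans (usub _ _))// /C addrA lerD ?umul//.
  rewrite (le_trans (ulin _))// lerD2l ler_wpM2r// ler_nat ltnW// ltn_mod//.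
have : (N %/ k.+1)%:R * u k.+1 <= N%:R * (u k.+1 / k.+1%:R).
  rewrite [leRHS]mulrCA [leLHS]mulrC ler_wpM2l//.
  by rewrite ler_pdivlMr ?ltr0n// -natrM ler_nat leq_divM.
move=> h1 h2.
have : u N / N%:R <= u k.+1 / k.+1%:R + C / N%:R.
  rewrite ler_pdivrMr// mulrDl divfK ?gt_eqF// [_ / k.+1%:R * _]mulrC.
  exact: le_trans h2 (lerD h1 _).
move/le_trans; apply; rewrite [leRHS](_ : _ = L + e / 2 + e / 2); last by lra.
by rewrite lerD// ltW.
Unshelve. all: by end_near. Qed.

Section Blocks.
Variables (R : realType) (n : nat) (X : set (fullshift n)).
Hypothesis sX : shift_space X.
Local Notation A := (alphabet n).
Implicit Types (x y : fullshift n).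

Lemma shift_space_shift (i : int) x : X x -> X (fun j => x (j + i)).
Proof.
have [_ _ shX] := sX.
have forw (k : nat) y : X y -> X (fun j => y (j + k%:Z)).
  elim: k y => [|k IH] y Xy.
    by rewrite (_ : (fun j => _) = y)//; apply/funext => j; rewrite addr0.
  have Xsy : X (Defs.shift y) by rewrite -shX; exists y.
  have := IH _ Xsy; rewrite /Defs.shift.
  by under eq_fun do rewrite -addrA [_ + 1]addrC -intS.
have backw (k : nat) y : X y -> X (fun j => y (j - k%:Z)).
  elim: k y => [|k IH] y Xy.
    by rewrite (_ : (fun j => _) = y)//; apply/funext => j; rewrite subr0.
  have [z Xz zy] : (@Defs.shift n @` X) y by rewrite shX.
  rewrite -zy (_ : (fun j => _) = (fun j => z (j - k%:Z))); first exact: IH.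
  by apply/funext => j; rewrite /Defs.shift; congr z; lia.
by case: i => k Xx; [exact: forw|rewrite NegzE; exact: backw].
Qed.

Definition blocks m : {set m.-tuple A} := [set w | `[< occurs X w >]]%SET.

Lemma card_blocks m : #|blocks m| = block_count X m.
Proof. by rewrite /blocks cardsE. Qed.

Definition word_of m x : m.-tuple A := [tuple x (i : nat)%:Z | i < m].

Lemma word_of_block m x : X x -> word_of m x \in blocks m.
Proof.
move=> Xx; rewrite inE; apply/asboolP; exists x, 0; split=> // j.
by rewrite tnth_mktuple add0r.
Qed.

Lemma blocksP m w : w \in blocks m -> exists2 x, X x & w = word_of m x.
Proof.
rewrite inE => /asboolP[x [i [Xx wx]]].
exists (fun j => x (j + i)); first exact: shift_space_shift.
by apply: eq_from_tnth => j; rewrite wx tnth_mktuple addrC.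
Qed.

Lemma block_count_gt0 m : (0 < block_count X m)%N.
Proof.
have [[x Xx] _ _] := sX; rewrite -card_blocks card_gt0; apply/set0Pn.
by exists (word_of m x); exact: word_of_block.
Qed.

Lemma block_countD k l :
  (block_count X (k + l) <= block_count X k * block_count X l)%N.
Proof.
rewrite -!card_blocks -cardsX.
pose f (w : (k + l).-tuple A) : k.-tuple A * l.-tuple A :=
  ([tuple tnth w (lshift l i) | i < k], [tuple tnth w (rshift k i) | i < l]).
have finj : injective f.
  move=> v w fvw.
  have e1 i : tnth v (lshift l i) = tnth w (lshift l i).
    by have := congr1 (fun t => tnth t.1 i) fvw; rewrite !tnth_mktuple.
  have e2 i : tnth v (rshift k i) = tnth w (rshift k i).
    by have := congr1 (fun t => tnth t.2 i) fvw; rewrite !tnth_mktuple.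
  by apply: eq_from_tnth => i; case: (split_ordP i) => j ->.
rewrite -(card_imset _ finj); apply/subset_leq_card/fintype.subsetP => vw.
move=> /imsetP[w /blocksP[x Xx ->] ->].
rewrite finset.in_setX /=; apply/andP; split.
  rewrite (_ : [tuple _ | _ < _] = word_of k x) ?word_of_block//.
  by apply: eq_from_tnth => i; rewrite !tnth_mktuple.
have Xkx := shift_space_shift k%:Z Xx.
rewrite (_ : [tuple _ | _ < _] = word_of l (fun j => x (j + k%:Z))) ?word_of_block//.
by apply: eq_from_tnth => i; rewrite !tnth_mktuple /= addrC.
Qed.

Lemma entropy_cvg : cvgn (fun m => ln ((block_count X m)%:R : R) / m%:R).
Proof.
apply: (@fekete R (fun m => ln ((block_count X m)%:R : R))) => [k|k l].
  by rewrite ln_ge0// ler1n block_count_gt0.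
have pos m : (block_count X m)%:R \is @Num.pos R.
  by rewrite posrE ltr0n block_count_gt0.
by rewrite -lnM// ler_ln ?posrE ?mulr_gt0 -?posrE// -natrM ler_nat block_countD.
Qed.

Variable a : A.

Definition nonsafe_count (x : int -> A) m : nat :=
  \sum_(i < m) (x (i : nat)%:Z != a).

Lemma nonsafe_countE x m :
  nonsafe_count x m = #|[set i : 'I_m | x (i : nat)%:Z != a]%SET|.
Proof.
rewrite -sum1_card big_mkcond /=; apply: eq_bigr => i _.
by rewrite inE; case: (_ != _).
Qed.

(** Each subset of the non-safe positions may be kept while the others are
    replaced by [a], and different subsets give different blocks. *)
Lemma block_count_ge_exp x m : safe_symbol X a -> X x ->
  (2 ^ nonsafe_count x m <= block_count X m)%N.
Proof.
move=> safe Xx; rewrite nonsafe_countE -card_powerset -card_blocks.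
set S := [set i : 'I_m | _]%SET.
pose f (T : {set 'I_m}) : m.-tuple A :=
  [tuple if i \in T then x (i : nat)%:Z else a | i < m].
have finj : {in powerset S &, injective f}.
  have memf T i : T \in powerset S -> (i \in T) = (tnth (f T) i != a).
    rewrite powersetE => /fintype.subsetP TS; rewrite tnth_mktuple; case: ifP => iT.
      by have := TS _ iT; rewrite inE => ->.
    by rewrite eqxx.
  by move=> T T' TS TS' fTT'; apply/setP => i; rewrite !memf// fTT'.
rewrite -(card_in_imset finj); apply/subset_leq_card/fintype.subsetP => w.
move=> /imsetP[T _ ->].
pose y : fullshift n := fun j =>
  if [exists i : 'I_m, (i \in T) && ((i : nat)%:Z == j)] then x j else a.
have Xy : X y by apply: (safe x) => // i; rewrite /y; case: ifP; [left|right].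
rewrite (_ : f T = word_of m y) ?word_of_block//.
apply: eq_from_tnth => i; rewrite !tnth_mktuple /y.
suff -> : [exists j : 'I_m, (j \in T) && ((j : nat)%:Z == (i : nat)%:Z)] =
  (i \in T) by [].
apply/existsP/idP => [[j /andP[jT /eqP[ji]]]|iT]; first by rewrite -(ord_inj ji).
by exists i; rewrite iT eqxx.
Qed.

Lemma entropy_gt0 (c : R) : safe_symbol X a -> 0 < c ->
  (forall m, exists2 x, X x & c * m%:R <= (nonsafe_count x m)%:R) ->
  0 < topological_entropy R X.
Proof.
move=> safe c0 dense; have ln2 : 0 < ln (2 : R) by rewrite ln_gt0// ltr1n.
apply: (@lt_le_trans _ _ (c * ln 2)); first exact: mulr_gt0.
apply: limr_ge; first exact: entropy_cvg.
near=> m; have m0 : (0 < m)%N by near: m; exists 1%N.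
have [x Xx cx] := dense m.
rewrite ler_pdivlMr ?ltr0n// mulrAC (le_trans (ler_wpM2r (ltW ln2) cx))//.
rewrite mulr_natl -lnXn// -natrX ler_ln ?posrE ?ltr0n ?expn_gt0 ?block_count_gt0//.
by rewrite ler_nat block_count_ge_exp.
Unshelve. all: by end_near. Qed.

(** The generating function of the number of non-safe entries over all words of
    length [m]. *)
Lemma block_count_weight (z : R) m :
  \sum_(w : m.-tuple A) \prod_(i < m) (if tnth w i == a then 1 else z) =
  (1 + n.+1%:R * z) ^+ m.
Proof.
have -> : 1 + n.+1%:R * z = \sum_(b : A) (if b == a then 1 else z).
  rewrite (bigD1 a)//= eqxx; congr (_ + _).
  rewrite (eq_bigr (fun=> z)); last by move=> b /negbTE ->.
  rewrite sumr_const mulr_natl; congr (_ *+ _).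
  by have := cardC1 a; rewrite card_ord => ->.
rewrite -[X in _ ^+ X](card_ord m) -prodr_const bigA_distr_bigA /=.
pose h (f : {ffun 'I_m -> A}) : m.-tuple A := [tuple f i | i < m].
rewrite (reindex h) /=.
  by apply: eq_bigr => f _; apply: eq_bigr => i _; rewrite tnth_mktuple.
exists (fun w : m.-tuple A => [ffun i => tnth w i]) => [f _|w _].
  by apply/ffunP => i; rewrite ffunE tnth_mktuple.
by apply: eq_from_tnth => i; rewrite tnth_mktuple ffunE.
Qed.

(** A Chernoff bound: a block has at most [c * m] non-safe entries, so its
    weight in [block_count_weight] is at least [z] to the power [c * m]. *)
Lemma block_count_le_expR (z c : R) m : 0 < z <= 1 ->
  (forall x, X x -> (nonsafe_count x m)%:R <= c * m%:R) ->
  (block_count X m)%:R <= expR (m%:R * (n.+1%:R * z - c * ln z)).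
Proof.
move=> /andP[z0 z1] cX.
have lnz : ln z <= 0 by rewrite ln_le0.
have : (block_count X m)%:R * expR (c * m%:R * ln z) <=
    expR (m%:R * (n.+1%:R * z)).
  apply: (@le_trans _ _ ((1 + n.+1%:R * z) ^+ m)); last first.
    rewrite expRM_natl lerXn2r ?nnegrE ?expR_ge0 ?expR_ge1Dx//.
    by rewrite addr_ge0// mulr_ge0// ltW.
  rewrite -block_count_weight -card_blocks mulr_natl -sumr_const.
  rewrite [leRHS](bigID (mem (blocks m))) /=.
  apply: (le_trans _ (ler_wpDr _ (lexx _))); last first.
    apply: sumr_ge0 => w _; apply: prodr_ge0 => i _.
    by case: ifP => // _; exact: ltW.
  apply: ler_sum => w /blocksP[x Xx ->].
  rewrite (_ : \prod_(i < m) _ = z ^+ nonsafe_count x m).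
    rewrite -[X in X ^+ _](lnK (x := z)) ?posrE// -expRM_natl ler_expR.
    by rewrite ler_wnM2r// cX.
  rewrite /nonsafe_count -prodrXr; apply: eq_bigr => i _.
  by rewrite tnth_mktuple; case: (_ == a).
rewrite -ler_pdivlMr ?expR_gt0// -expRB => /le_trans; apply.
by rewrite ler_expR mulrBr lerD2l lerN2 mulrCA mulrA.
Qed.

End Blocks.

(** * Empirical contents *)
Section EmpiricalContents.
Variables (R : realType) (B : Type).
Implicit Types (x : int -> B) (C : set (int -> B)).

Definition empirical (m : nat) x C : R :=
  (\sum_(i < m) \1_C (iter i (@translate B) x)) / m%:R.

Lemma empirical_prob m x : (0 < m)%N -> prob_content (empirical m x).
Proof.
move=> m0; have m0' : m%:R != 0 :> R by rewrite pnatr_eq0 -lt0n.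
split.
- by move=> C _; rewrite divr_ge0// sumr_ge0.
- move=> C D _ _ CD; rewrite -mulrDl -big_split /=; congr (_ / _).
  apply: eq_bigr => i _; rewrite !indicE in_setU.
  have [xC|xC] := boolP (_ \in C); have [xD|xD] := boolP (_ \in D);
    rewrite /= ?addr0 ?add0r//.
  move: xC xD; rewrite !inE => xC xD.
  by have : (C `&` D) (iter i (@translate B) x) by []; rewrite CD.
- rewrite /empirical (eq_bigr (fun=> 1)) ?sumr_const ?card_ord ?divff// => i _.
  by rewrite indicT.
Qed.

(** The difference telescopes to the first and the last visit. *)
Lemma empirical_shift m x C : (0 < m)%N ->
  `|empirical m x (@translate B @^-1` C) - empirical m x C| <= m%:R^-1.
Proof.
move=> m0; rewrite -mulrBl normrM [`|_^-1|]ger0_norm ?invr_ge0//.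
rewrite ler_piMl ?invr_ge0//.
pose f i : R := \1_C (iter i (@translate B) x).
have -> : \sum_(i < m) \1_(@translate B @^-1` C) (iter i (@translate B) x) -
    \sum_(i < m) \1_C (iter i (@translate B) x) = f m - f 0%N.
  rewrite -(telescope_sumr f (leq0n m)) big_mkord -sumrB.
  by apply: eq_bigr => i _; rewrite /f !indicE.
rewrite /f !indicE; case: (_ \in C); case: (_ \in C);
  by rewrite ?subrr ?subr0 ?sub0r ?normrN ?normr0 ?normr1 ?ler01.
Qed.

Variable X : set (int -> B).
Hypothesis XT : forall x, X x -> X (translate x).

Lemma empirical_support m x C : X x -> C `&` X = set0 -> empirical m x C = 0.
Proof.
move=> Xx CX; rewrite /empirical big1 ?mul0r// => i _.
rewrite indicE memNset// => Cx.
suff : (C `&` X) (iter i (@translate B) x) by rewrite CX.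
by split=> //; elim: (nat_of_ord i) => //= k; exact: XT.
Qed.

(** The boundary terms of [empirical_shift] vanish in the limit because the
    lengths [m] are unbounded. *)
Lemma inv_content_exists (D : set (int -> B)) (c : R) : cylset D -> 0 <= c ->
  (forall M : nat, exists2 m, (M < m)%N & exists2 x, X x & c <= empirical m x D) ->
  exists2 m, inv_content X m & c <= m D.
Proof.
move=> cD c0 hD; have [U UU oU] := free_ultrafilter.
have /choice[d dP] (M : nat) : exists d : nat * (int -> B),
    [/\ (M < d.1)%N, X d.2 & c <= empirical d.1 d.2 D].
  by have [m Mm [x Xx cx]] := hD M; exists (m, x).
pose mm M := empirical (d M).1 (d M).2.
have pmm : U [set M | prob_content (mm M)].
  apply: nearW => M; apply: empirical_prob.
  by have [Md _ _] := dP M; exact: leq_ltn_trans Md.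
exists (content_ulim U mm); last first.
  apply: ulim_ge; first exact: content_bounded.
  by apply: nearW => M; have [] := dP M.
split.
- exact: content_ulim_prob.
- move=> C cC; apply: content_ulim_shift => //.
  have h : (fun M => mm M (@translate B @^-1` C) - mm M C) @ \oo --> (0 : R).
    apply/cvgrPdist_le => e e0; near=> M.
    have [Md _ _] := dP M; rewrite sub0r normrN.
    apply: le_trans (empirical_shift _ _ (leq_ltn_trans (leq0n M) Md)) _.
    apply: (@le_trans _ _ M.+1%:R^-1).
      by rewrite lef_pV2 ?posrE ?ltr0n ?ler_nat// (leq_ltn_trans (leq0n M) Md).
    have : `|0 - M.+1%:R^-1| <= e :> R.
      near: M; have /cvgrPdist_le := @cvg_harmonic R; exact.
    by rewrite sub0r normrN ger0_norm.
  by move=> A /h; exact: oU.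
- move=> C cC CX; apply: ulim_near_cst; apply: nearW => M.
  by apply: empirical_support => //; have [] := dP M.
Unshelve. all: by end_near. Qed.

End EmpiricalContents.

(** * Entropy and invariant measures *)
Section ShiftSpace.
Variables (R : realType) (n : nat) (X : set (fullshift n)).
Hypothesis sX : shift_space X.
Local Notation A := (alphabet n).
Variable a : A.

(** In [block_count_le_expR] choose first [z] and then [c] so small that both
    terms of the exponent are at most [h / 4]; if [c] were not attained as a
    frequency for long blocks, the entropy [h] would be at most [h / 2]. *)
Lemma entropy_gt0_dense_points : 0 < topological_entropy R X ->
  exists2 c : R, 0 < c & forall M : nat, exists2 m, (M < m)%N &
    exists2 x, X x & c * m%:R < (nonsafe_count a x m)%:R.
Proof.
set h := topological_entropy R X => h0.
pose z : R := Num.min 1 (h / 4 / n.+1%:R).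
have n0 : 0 < n.+1%:R :> R by rewrite ltr0n.
have z0 : 0 < z by rewrite lt_min ltr01 !divr_gt0.
have z1 : z <= 1 by rewrite ge_min lexx.
have nz : n.+1%:R * z <= h / 4 by rewrite mulrC -ler_pdivlMr// ge_min lexx orbT.
have lnz : ln z <= 0 by rewrite ln_le0.
have d0 : 0 < 1 - ln z by lra.
pose c := h / 4 / (1 - ln z).
have c0 : 0 < c by rewrite !divr_gt0.
have cz : - (c * ln z) <= h / 4.
  have -> : h / 4 = c * (1 - ln z) by rewrite /c divfK ?gt_eqF.
  by rewrite mulrBr mulr1; lra.
exists c => //; apply: contrapT => /existsNP[M nM].
suff : h <= h / 2 by lra.
apply: limr_le; first exact: entropy_cvg.
near=> m; have m0 : (0 < m)%N by near: m; exists 1%N.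
have Mm : (M < m)%N by near: m; exists M.+1.
rewrite ler_pdivrMr ?ltr0n// -ler_expR lnK ?posrE ?ltr0n ?block_count_gt0//.
apply: le_trans (block_count_le_expR sX (a := a) (z := z) (c := c) _ _) _.
- by rewrite z0.
- move=> x Xx; rewrite leNgt; apply/negP => cx; apply: nM; exists m => //.
  by exists x.
rewrite ler_expR mulrC ler_wpM2r//; lra.
Unshelve. all: by end_near. Qed.

Lemma empirical_nonsafe m x :
  empirical R m x (nonsafe a) = (nonsafe_count a x m)%:R / m%:R.
Proof.
rewrite /empirical /nonsafe_count natr_sum; congr (_ / _).
apply: eq_bigr => i _; rewrite indicE; congr (nat_of_bool _)%:R.
by apply/idP/idP; rewrite inE /nonsafe /= iter_translate add0r => /eqP.
Qed.

Section InvariantMeasure.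
Variable mu : probability (borel n) R.
Hypotheses (muX : mu X = 1%E) (imu : shift_invariant mu).

Definition nonsafe_at (i : int) : set (borel n) := [set x | x i <> a].

Lemma measurable_nonsafe_at i : measurable (nonsafe_at i).
Proof.
apply: sub_sigma_algebra; apply: cylset_open.
exact: (cylset_coord i [set b | b <> a]).
Qed.

Lemma measurable_shift_space : measurable (X : set (borel n)).
Proof.
rewrite -[X]setCK; apply: measurableC; apply: sub_sigma_algebra.
by apply: closed_openC; case: sX.
Qed.

Lemma measure_nonsafe_at i : mu (nonsafe_at i) = mu (nonsafe_at 0).
Proof.
have step j : mu (nonsafe_at (j + 1)) = mu (nonsafe_at j).
  by rewrite -(imu (measurable_nonsafe_at j)).
case: i => k; first by elim: k => // k <-; rewrite intS addrC step.
elim: k => [|k <-]; first by rewrite -step NegzE.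
by rewrite -(step (Negz k.+1)); congr (mu (nonsafe_at _)); rewrite !NegzE; lia.
Qed.

(** The number of non-safe entries in the window has mean [m] times the mass of
    [nonsafe a], and its maximum over [X] is at least its mean. *)
Lemma measure_dense_point m :
  exists2 x, X x & fine (mu (nonsafe a)) * m%:R <= (nonsafe_count a x m)%:R.
Proof.
have [[x0 Xx0] _ _] := sX.
have exK : exists k, `[< exists2 x, X x & nonsafe_count a x m = k >].
  by exists (nonsafe_count a x0 m); apply/asboolP; exists x0.
have boundK k : `[< exists2 x, X x & nonsafe_count a x m = k >] -> (k <= m)%N.
  move=> /asboolP[x _ <-]; rewrite /nonsafe_count.
  by rewrite -[X in (_ <= X)%N]card_ord -sum1_card leq_sum// => i _; exact: leq_b1.
case: (ex_maxnP exK boundK) => K /asboolP[x Xx xK] Kmax.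
exists x => //; rewrite xK.
have mX := measurable_shift_space.
have nonsafeE : mu (nonsafe a) = (prob mu (nonsafe_at 0))%:E.
  by rewrite -probE//; exact: measurable_nonsafe_at.
have intE : (\int[mu]_(y in X) \sum_(i < m) (\1_(nonsafe_at (i : nat)%:Z) y)%:E =
    (m%:R * prob mu (nonsafe_at 0))%:E)%E.
  rewrite ge0_integral_sum//; last first.
    move=> i; apply/measurable_EFinP; apply: measurable_indic.
    exact: measurable_nonsafe_at.
  rewrite (eq_bigr (fun=> (prob mu (nonsafe_at 0))%:E)) => [|i _].
    by rewrite sumEFin sumr_const card_ord mulr_natl.
  rewrite integral_indic//; last exact: measurable_nonsafe_at.
  have mi := measurable_nonsafe_at (i : nat)%:Z.
  have mnX : measurable (~` X : set (borel n)) by exact: measurableC.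
  have nX : prob mu (~` X) = 0 by rewrite probC// /prob muX subrr.
  rewrite -(probE mu (measurable_nonsafe_at 0)) -(measure_nonsafe_at (i : nat)%:Z).
  rewrite (probE mu mi) (probE mu (measurableI _ _ mi mX)) (prob_split mu mi mX).
  suff -> : prob mu (nonsafe_at (i : nat)%:Z `\` X) = 0 by rewrite addr0.
  apply/eqP; rewrite eq_le prob_ge0 andbT -nX.
  by apply: le_prob => //; exact: measurableD.
rewrite nonsafeE /= mulrC -lee_fin -intE.
apply: (@le_trans _ _ (\int[mu]_(y in X) (cst (K%:R%:E) y))%E).
  apply: ge0_le_integral => //.
  - by move=> y _; rewrite sume_ge0// => i _; rewrite lee_fin.
  - apply: emeasurable_sum => i; apply/measurable_EFinP; apply: measurable_indic.
    exact: measurable_nonsafe_at.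
  - move=> y Xy; rewrite sumEFin lee_fin /=.
    rewrite (_ : \sum_(i < m) _ = (nonsafe_count a y m)%:R).
      by rewrite ler_nat; apply: Kmax; apply/asboolP; exists y.
    rewrite /nonsafe_count natr_sum; apply: eq_bigr => i _; rewrite indicE.
    congr (nat_of_bool _)%:R.
    by apply/idP/idP; rewrite inE /nonsafe_at /= => /eqP.
by rewrite integral_cst// muX mule1.
Qed.

(** The sequences other than the constant one form a countable union of
    translates of the null event [nonsafe a]. *)
Lemma measure_safe_point : mu (nonsafe a) = 0%E ->
  forall C : set (borel n), measurable C -> mu C = (\1_C (fun=> a))%:E.
Proof.
move=> mu0 C mC.
pose S k := nonsafe_at k%:Z `|` nonsafe_at (Negz k).
have mS k : measurable (S k) by apply: measurableU; exact: measurable_nonsafe_at.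
have muS : mu (\bigcup_k S k) = 0%E.
  apply/eqP; rewrite eq_le measure_ge0 andbT.
  apply: le_trans (measure_sigma_subadditive mu _ _ (@subset_refl _ _)) _ => //.
    exact: bigcupT_measurable.
  rewrite eseries0// => k _ _; apply/eqP; rewrite eq_le measure_ge0 andbT.
  apply: (@le_trans _ _ (mu (nonsafe_at k%:Z) + mu (nonsafe_at (Negz k)))%E).
    by apply: measureU2; exact: measurable_nonsafe_at.
  by rewrite !measure_nonsafe_at mu0 adde0.
have SE (D : set (borel n)) : measurable D -> ~ D (fun=> a) -> mu D = 0%E.
  move=> mD nD; apply/eqP; rewrite eq_le measure_ge0 andbT -muS.
  apply: le_measure; rewrite ?inE//; first exact: bigcupT_measurable.
  move=> x Dx; apply: contrapT => nS; apply: nD.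
  suff <- : x = (fun=> a) by [].
  apply/funext => i; apply: contrapT => xi; apply: nS.
  by case: i xi => k xi; exists k => //; [left|right].
rewrite indicE; have [Ca|Ca] := pselect (C (fun=> a)); last first.
  by rewrite memNset// SE.
rewrite mem_set//= -[C]setCK probability_setC; last exact: measurableC.
by rewrite SE ?sube0//; exact: measurableC.
Qed.

End InvariantMeasure.

End ShiftSpace.

Lemma hereditary_safe n (X : set (fullshift n)) :
  hereditary X -> safe_symbol X (ord0 : alphabet n).
Proof. by move=> hX y z Xy yz; apply: hX Xy _ => i; case: (yz i) => ->. Qed.

Lemma uncountable_family (R : realType) T (f : R -> T) (S : set T) :
  {in `[0, 1] &, injective f} -> (forall p, 0 <= p <= 1 -> S (f p)) -> ~ countable S.
Proof.
move=> finj fS cS.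
have : countable (f @` `[0, 1]%classic).
  apply: sub_countable cS; apply: subset_card_le => _ [p p01 <-].
  by apply: fS; move: p01; rewrite /= in_itv.
have finj' : {in `[0, 1]%classic &, injective f}.
  by move=> p q; rewrite !inE /= => p1 q1; exact: finj.
rewrite (eq_countable (inj_card_eq finj')) => /countable_lebesgue_measure0.
by rewrite lebesgue_measure_itv /= lte_fin ltr01 sube0 => -[] /eqP; rewrite oner_eq0.
Qed.

Theorem corollary9 (R : realType) (n : nat) (X : set (fullshift n))
    (X_shift_space : shift_space X)
    (X_safe : (exists a : alphabet n, safe_symbol X a) \/ hereditary X) :
  0 < topological_entropy R X <->
  uncountably_many_measures (ergodic_measures R X).
Proof.
have {X_safe} [a safe] : exists a : alphabet n, safe_symbol X a.
  by case: X_safe => // /hereditary_safe; exists ord0.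
have cyl_nonsafe : cylset (nonsafe a : set (int -> alphabet n)).
  exact: (cylset_coord 0 [set b | b <> a]).
have m_nonsafe : measurable (nonsafe a : set (borel n)).
  exact: (measurable_nonsafe_at a 0).
split=> [h0 cM|uM].
- have [c c0 dense] := entropy_gt0_dense_points X_shift_space a h0.
  have [m0 im0 m0D] : exists2 m, inv_content X m & c <= m (nonsafe a) :> R.
    apply: inv_content_exists (ltW c0) _ => //.
      by move=> x Xx; exact: (shift_space_shift X_shift_space 1 Xx).
    move=> M; have [m Mm [x Xx cx]] := dense M; exists m => //; exists x => //.
    by rewrite empirical_nonsafe ler_pdivlMr ?ltr0n ?(leq_ltn_trans _ Mm)// ltW.
  have [m em mD] := extreme_content_exists cyl_nonsafe im0.
  have D0 : 0 < m (nonsafe a) by exact: lt_le_trans c0 (le_trans m0D mD).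
  have cX : closed X by case: X_shift_space.
  (* Outside [0, 1] any probability will do: it only makes nu a total function. *)
  have nuP (p : R) : exists nu : probability (borel n) R, 0 <= p <= 1 ->
      ergodic_measures R X nu /\ nu (nonsafe a) = (p * m (nonsafe a))%:E.
    have [p01|np] := pselect (0 <= p <= 1); last first.
      have p0 : 0 <= (0 : R) <= 1 by rewrite lexx ler01.
      have [nu _ _] := thinned_measure p0 cX safe em.
      by exists nu.
    by have [nu ? ?] := thinned_measure p01 cX safe em; exists nu.
  have [nu nuE] := choice nuP.
  apply: (@uncountable_family R _ (fun p => borel_restriction (nu p))) cM.
    move=> p q; rewrite !in_itv /= => p01 q01.
    move=> /(congr1 (fun f => f (exist _ (nonsafe a : set (borel n)) m_nonsafe))).
    rewrite /borel_restriction /= (nuE _ p01).2 (nuE _ q01).2 => -[].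
    by apply: mulIf; rewrite gt_eqF.
  by move=> p p01; exists (nu p) => //; exact: (nuE _ p01).1.
- apply: contrapT => h0; apply: uM.
  pose delta : {C : set (borel n) | measurable C} -> \bar R :=
    fun C => (\1_(sval C) (fun=> a : alphabet n))%:E.
  apply: (@sub_countable _ _ _ [set delta]); last exact: countable1.
  apply: subset_card_le => _ [mu [muX imu _] <-] /=.
  have mu0 : mu (nonsafe a) = 0%E.
    apply: contrapT => mu0; apply: h0.
    apply: (entropy_gt0 X_shift_space safe _
      (fun k => measure_dense_point X_shift_space a muX imu k)).
    rewrite fine_gt0//; apply/andP; split.
      by rewrite lt_neqAle measure_ge0 andbT eq_sym; apply/eqP.
    by rewrite (probE mu m_nonsafe) ltry.
  apply/funext => -[C mC]; rewrite /borel_restriction /delta /=.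
  exact: (measure_safe_point imu mu0 mC).
Qed.
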